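(* Let $(\xi_1,\dots,\xi_N)$ be a $\mathcal T_N$-configuration in $\mathbb R^{m\times n}\times\mathbb R^{m\times n}$ with data $(\rho,\gamma_1,\dots,\gamma_N,\kappa_1,\dots,\kappa_N)$, and let $\eta=\lambda\xi_i+(1-\lambda)\pi_i$ for some $1\le i\le N$ and $0\le\lambda\le1$. Then $\eta=\sum_{j=1}^N\nu_j\xi_j$ with $\nu_i=\lambda+(1-\lambda)\nu_i^i$ and $\nu_j=(1-\lambda)\nu_i^j$ for $j\ne i$, where $\nu_i^j$ are the coefficients of the cyclic averaging formula with $t_k=\chi_k=1/\kappa_k$. Moreover, for every bounded open $G\subset\mathbb R^{n+1}$ and $0<\delta<1$ there exists $(\varphi,\psi,g)\in C_0^\infty(G;\mathbb R^m\times\mathbb R^{m\times n}\times\mathbb R^{m\times n})$ with: (a) $\operatorname{div}\psi=0$, $\operatorname{div}g=\varphi$, and $\eta+(D\varphi,\partial_t\psi)\in[\mathcal T(\xi_1,\dots,\xi_N)]_\delta$ in $G$; (b) $\|\varphi\|_{L^\infty(G)}+\|\partial_t\varphi\|_{L^\infty(G)}+\|\partial_tg\|_{L^\infty(G)}<\delta$; (c) there exist pairwise disjoint open sets $G_1,\dots,G_N\subset\subset G$ with $\eta+(D\varphi,\partial_t\psi)=\xi_j$ in $G_j$ and $|G_j|\ge(1-\delta)\nu_j|G|$ for all $1\le j\le N$; in particular $\sum_j|G_j|\ge(1-\delta)|G|$.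
   Context: Wave cone: $\Gamma=\{(p\otimes a,B):p\in\mathbb R^m,\ a\in\mathbb R^n\setminus\{0\},\ B\in\mathbb R^{m\times n},\ Ba=0\}$, $p\otimes a=pa^T$. A $\mathcal T_N$-configuration ($N\ge2$) is an ordered $N$-tuple $(\xi_1,\dots,\xi_N)$ in $\mathbb R^{m\times n}\times\mathbb R^{m\times n}$ together with data $\rho\in\mathbb R^{m\times n}\times\mathbb R^{m\times n}$, $\gamma_1,\dots,\gamma_N\in\Gamma$ with $\gamma_1+\dots+\gamma_N=0$, and $\kappa_1,\dots,\kappa_N>1$, such that $\xi_1=\rho+\kappa_1\gamma_1$ and $\xi_i=\rho+\gamma_1+\dots+\gamma_{i-1}+\kappa_i\gamma_i$ ($2\le i\le N$). Set $\pi_1=\rho$, $\pi_i=\rho+\gamma_1+\dots+\gamma_{i-1}$, $\chi_i=1/\kappa_i$, and $\mathcal T(\xi_1,\dots,\xi_N)=\bigcup_{j=1}^N[\xi_j,\pi_j]$. Cyclic averaging coefficients: for $t_k\in(0,1)$ ($N$-periodic in $k$) and indices mod $N$, $\nu_i^{i-1}=t_{i-1}/(1-\prod_{k=1}^N(1-t_k))$ and $\nu_i^j=(1-t_{i-1})\cdots(1-t_{j+1})t_j/(1-\prod_{k=1}^N(1-t_k))$ for $i-N\le j\le i-2$. $D$, $\operatorname{div}$ (row-wise), $\partial_t$ refer to variables $(x,t)\in\mathbb R^n\times\mathbb R$; $S_\delta$ denotes the open $\delta$-neighborhood of a set $S$; $|\cdot|$ of a set is Lebesgue measure. *)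

(* Defs.v *)
From mathcomp Require Import all_boot all_order all_algebra.
From mathcomp Require Import all_classical all_reals all_analysis.
Import Order.TTheory GRing.Theory Num.Theory.
Import numFieldNormedType.Exports.
Set Implicit Arguments. Unset Strict Implicit. Unset Printing Implicit Defensive.
Local Open Scope ring_scope.
Local Open Scope classical_set_scope.

Definition wave_cone (R : realType) (m n : nat)
    (z : ('M[R]_(m, n) * 'M[R]_(m, n))%type) : Prop :=
  exists (p : 'cV[R]_m) (a : 'cV[R]_n) (B : 'M[R]_(m, n)),
    a != 0 /\ B *m a = 0 /\ z = (p *m a^T, B).

Definition tpi (R : realType) (m n N : nat)
    (rho : ('M[R]_(m, n) * 'M[R]_(m, n))%type)
    (gamma : 'I_N -> ('M[R]_(m, n) * 'M[R]_(m, n))%type) (i : 'I_N) :=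
  rho + \sum_(j < N | (j < i)%N) gamma j.

Definition TN_config (R : realType) (m n N : nat)
    (xi : 'I_N -> ('M[R]_(m, n) * 'M[R]_(m, n))%type)
    (rho : ('M[R]_(m, n) * 'M[R]_(m, n))%type)
    (gamma : 'I_N -> ('M[R]_(m, n) * 'M[R]_(m, n))%type)
    (kappa : 'I_N -> R) : Prop :=
  [/\ (2 <= N)%N,
      (forall i, wave_cone (gamma i)),
      \sum_(i < N) gamma i = 0,
      (forall i, 1 < kappa i) &
      (forall i, xi i = tpi rho gamma i + kappa i *: gamma i)].

(* Cyclic averaging coefficients nu_i^j (indices mod N, 0-based).
   For j = i-1-d mod N with 0 <= d <= N-1:
   nu_i^j = (1-t_{i-1})...(1-t_{i-d}) t_j / (1 - prod_k (1-t_k)).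
   (d = 0 gives nu_i^{i-1} = t_{i-1}/(1-prod); d = 1..N-1 gives the
   case i-N <= j <= i-2 of the paper.) *)
Definition cyc_nu (R : realType) (N : nat) (t : 'I_N -> R) (i j : 'I_N) : R :=
  let d := (((i + N).-1 - j) %% N)%N in
  (\prod_(1 <= l < d.+1) (1 - t (insubd i ((i + N - l) %% N)%N))) * t j
    / (1 - \prod_(k < N) (1 - t k)).

(* d-th index arithmetic: insubd i k is the ordinal with value k (k < N
   always holds here since k is reduced mod N, N > 0). *)

Definition segment (R : realType) (m n : nat)
    (a b : ('M[R]_(m, n) * 'M[R]_(m, n))%type) :
    set ('M[R]_(m, n) * 'M[R]_(m, n))%type :=
  [set z | exists l : R, 0 <= l <= 1 /\ z = l *: a + (1 - l) *: b].

Definition Tset (R : realType) (m n N : nat)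
    (xi : 'I_N -> ('M[R]_(m, n) * 'M[R]_(m, n))%type)
    (rho : ('M[R]_(m, n) * 'M[R]_(m, n))%type)
    (gamma : 'I_N -> ('M[R]_(m, n) * 'M[R]_(m, n))%type) :=
  \bigcup_(j in [set: 'I_N]) segment (xi j) (tpi rho gamma j).

Definition dist2 (R : realType) (m n : nat)
    (z w : ('M[R]_(m, n) * 'M[R]_(m, n))%type) : R :=
  Num.max `|z.1 - w.1| `|z.2 - w.2|.

Definition nbhd_delta (R : realType) (m n : nat)
    (S : set ('M[R]_(m, n) * 'M[R]_(m, n))%type) (d : R) :=
  [set z | exists2 s, S s & dist2 z s < d].

(* Analysis on R^{n+1} = R^n_x x R_t, points p : 'rV[R]_(n.+1);
   coordinates x_k (k : 'I_n) are the first n entries, t is the last one. *)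

Definition xcoord (n : nat) (k : 'I_n) : 'I_(n.+1) := widen_ord (leqnSn n) k.
Definition tcoord (n : nat) : 'I_(n.+1) := ord_max.

Definition unitv (R : realType) (d : nat) (k : 'I_d) : 'rV[R]_d := delta_mx 0 k.

Definition partial (R : realType) (d : nat) (W : normedModType R)
    (k : 'I_d) (f : 'rV[R]_d -> W) : 'rV[R]_d -> W :=
  fun p => 'D_(unitv R k) f p.

Definition iter_partial (R : realType) (d : nat) (W : normedModType R)
    (s : seq 'I_d) (f : 'rV[R]_d -> W) : 'rV[R]_d -> W :=
  foldr (fun k g => partial k g) f s.

Definition smooth (R : realType) (d : nat) (W : normedModType R)
    (f : 'rV[R]_d -> W) : Prop :=
  forall s : seq 'I_d, (continuous (iter_partial s f)) /\
    (forall (k : 'I_d) (p : 'rV[R]_d), derivable (iter_partial s f) p (unitv R k)).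

Definition compactly_contained (R : realType) (d : nat) (A G : set 'rV[R]_d) :=
  compact (closure A) /\ closure A `<=` G.

Definition Cc_infty (R : realType) (d : nat) (W : normedModType R)
    (G : set 'rV[R]_d) (f : 'rV[R]_d -> W) : Prop :=
  smooth f /\ compactly_contained [set p | f p != 0] G.

Definition Dx (R : realType) (m n : nat) (phi : 'rV[R]_(n.+1) -> 'cV[R]_m)
    (p : 'rV[R]_(n.+1)) : 'M[R]_(m, n) :=
  \matrix_(r < m, k < n) (partial (xcoord k) phi p) r 0.

Definition dt (R : realType) (n : nat) (W : normedModType R)
    (f : 'rV[R]_(n.+1) -> W) : 'rV[R]_(n.+1) -> W := partial (tcoord n) f.

Definition divx (R : realType) (m n : nat) (psi : 'rV[R]_(n.+1) -> 'M[R]_(m, n))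
    (p : 'rV[R]_(n.+1)) : 'cV[R]_m :=
  \col_(r < m) \sum_(k < n) (partial (xcoord k) psi p) r k.

Definition box (R : realType) (d : nat) (a b : 'rV[R]_d) : set 'rV[R]_d :=
  [set x | forall j, a 0 j < x 0 j < b 0 j].

Definition boxvol (R : realType) (d : nat) (a b : 'rV[R]_d) : R :=
  \prod_(j < d) Num.max (b 0 j - a 0 j) 0.

Definition leb_measure (R : realType) (d : nat) (A : set 'rV[R]_d) : \bar R :=
  ereal_inf [set (\sum_(0 <= i <oo) ((boxvol (ab.1 i) (ab.2 i))%:E))%E
            | ab in [set ab : (nat -> 'rV[R]_d) * (nat -> 'rV[R]_d) |
                      A `<=` \bigcup_i box (ab.1 i) (ab.2 i)]].

(* sup norm over G (for continuous functions = L^infty(G) norm) *)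
Definition supnorm (R : realType) (d : nat) (W : normedModType R)
    (G : set 'rV[R]_d) (f : 'rV[R]_d -> W) : \bar R :=
  ereal_sup [set (`|f p|)%:E | p in G].

Definition chi (R : realType) (N : nat) (kappa : 'I_N -> R) (k : 'I_N) : R :=
  1 / kappa k.

Definition nu_eta (R : realType) (N : nat) (kappa : 'I_N -> R) (i : 'I_N)
    (lambda : R) (j : 'I_N) : R :=
  if j == i then lambda + (1 - lambda) * cyc_nu (chi kappa) i i
  else (1 - lambda) * cyc_nu (chi kappa) i j.

(* Main.v *)
(** The segment from [xi_i] to [pi_i] points in the wave cone, so [eta] can be
    split into [xi_i] and [pi_i] by a plane wave: with [u = eps^2 Z h(s / eps)],
    [s] linear with space-time gradient [(a, c)], [Z] a cutoff and [h''] a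
    two-valued profile (up to short transitions), put [phi = p (a.grad u)],
    [g = u (p a^T)] and let the [r]-th row of [psi] be
    [(B_r (a.grad u) - a (B_r.grad u)) / c]; the divergence constraints are then
    identities, and all error terms are [O(eps)], or [O(c)] for [dt phi].
    The sets where the two values are attained are intersections with strips,
    and translation invariance alone shows that these have the right proportion
    of the volume.  On the set where [pi_i] is attained one splits again, since
    [pi_i] lies on the segment from [xi_(i-1)] to [pi_(i-1)]; after [k] rounds
    the volume carrying no [xi_j] has decayed geometrically, and the weights
    collected by the [xi_j] converge to the solution [nu] of the one-step
    recursion, which is the cyclic average. *)
Require Import Defs.
From mathcomp Require Import all_boot all_order all_algebra.
From mathcomp Require Import all_classical all_reals all_analysis.
From HB Require Import structures.
From mathcomp Require Import ring lra zify.
Import Order.TTheory GRing.Theory Num.Theory.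
Import numFieldNormedType.Exports.
Set Implicit Arguments. Unset Strict Implicit. Unset Printing Implicit Defensive.
Local Open Scope ring_scope.
Local Open Scope classical_set_scope.

(** * Lebesgue outer measure *)

Section OuterMeasure.
Variables (R : realType) (d : nat).
Local Notation V := 'rV[R]_d.+1.
Implicit Types (a b c : V) (A : set V).

(** All volume claims are proportions of $|G|$, so the measure of a box is never computed: open sets
    are Caratheodory measurable, and the rest is additivity, exhaustion and translation. The profile
    [h''] equals [1 - l] on a share of about [l] of each period and [- l] on most of the rest, with
    mean zero, so [h] and [h'] stay bounded and only second derivatives of [u] survive as [eps]
    tends to 0. Their leading part is [Z h''] times the two directional derivatives of [s]; [u] is
    divided by $|a|^2$ to normalize [a.grad s]. As $Ba=0$ gives [B_r.grad s = 0], only the first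
    term of [psi] counts, and the factor [c] of the time derivative cancels [1 / c]. That
    [div psi = 0] is the commutation of two derivatives. The obstacle is exactness: the values
    $\xi_j$ must be attained exactly on sets compactly inside $G$. Hence [Z] is identically 1 on an
    open set nearly exhausting the volume, and each further round is supported compactly in the open
    set where the field is exactly $\pi_i$, so it meets no error of the earlier rounds. The
    tolerance is halved at each round: sup norms add up, and volume factors obey $(1-e/2)^2\ge
    1-e$. *)

Lemma boxvol_ge0 a b : 0 <= boxvol a b.
Proof. by apply: prodr_ge0 => j _; rewrite le_max lexx orbT. Qed.

Lemma boxvol0 : boxvol (0 : V) 0 = 0.
Proof. by rewrite /boxvol (bigD1 ord0)//= subrr maxxx mul0r. Qed.

Definition box_cover A (ab : (nat -> V) * (nat -> V)) : Prop :=
  A `<=` \bigcup_i box (ab.1 i) (ab.2 i).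

Lemma leb_measure_le A ab : box_cover A ab ->
  (leb_measure A <= \sum_(0 <= i <oo) ((boxvol (ab.1 i) (ab.2 i))%:E))%E.
Proof. by move=> h; apply: ereal_inf_lbound; exists ab. Qed.

Lemma leb_measure_ge0 A : (0 <= leb_measure A)%E.
Proof.
apply: le_ereal_inf_tmp => _ [ab _ <-].
by apply: nneseries_ge0 => i _ _; rewrite lee_fin boxvol_ge0.
Qed.

Lemma leb_measure0 : leb_measure (set0 : set V) = 0%E.
Proof.
apply/eqP; rewrite eq_le leb_measure_ge0 andbT.
have := @leb_measure_le set0 (fun=> 0, fun=> 0).
move=> /(_ (@sub0set _ _))/le_trans; apply.
by rewrite eseries0// => i _ _; rewrite boxvol0.
Qed.

Lemma leb_measure_mono : {homo @leb_measure R d.+1 : A B / A `<=` B >-> (A <= B)%E}.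
Proof.
move=> A B AB; apply: ereal_inf_le_tmp => _ [ab Bab <-].
by exists ab => //; exact: subset_trans Bab.
Qed.

(** Covers of the [A n] that are optimal up to $e/2^{n+1}$ are merged into one sequence of boxes by
    a bijection of [nat] with its square. *)
Lemma leb_measure_sigma_subadditive : sigma_subadditive (@leb_measure R d.+1).
Proof.
move=> A; have [[i ioo]|] := pselect (exists i, leb_measure (A i) = +oo%E).
  rewrite (eseries_pinfty _ _ ioo) ?leey// => n _.
  by rewrite -ltNye (lt_le_trans _ (leb_measure_ge0 _)).
rewrite -forallNE => Aoo.
suff add2e (e : {posnum R}) : (leb_measure (\bigcup_n A n)
    <= \sum_(i <oo) leb_measure (A i) + e%:num%:E)%E.
  by apply/lee_addgt0Pr => _/posnumP[].
rewrite (le_trans _ (epsilon_trick _ _ _))//; last first.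
  by move=> n; exact: leb_measure_ge0.
pose P n ab := box_cover (A n) ab /\ (\sum_(0 <= k <oo) (boxvol (ab.1 k) (ab.2 k))%:E
   <= leb_measure (A n) + (e%:num / (2 ^ n.+1)%:R)%:E)%E.
have [G PG] : {G : nat -> (nat -> V) * (nat -> V) & forall n, P n (G n)}.
  apply: (@choice _ _ P) => n; rewrite /P.
  have fA : leb_measure (A n) \is a fin_num.
    by rewrite ge0_fin_numE ?leb_measure_ge0// ltey; apply/eqP/Aoo.
  have en1 : 0 < e%:num / (2 ^ n.+1)%:R by [].
  have [_ [ab Aab <-] xS] := lb_ereal_inf_adherent en1 fA.
  by exists ab; split => //; exact/ltW.
pose v (i : nat * nat) := (boxvol ((G i.1).1 i.2) ((G i.1).2 i.2))%:E.
have v_ge0 i : (0 <= v i)%E by rewrite lee_fin boxvol_ge0.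
apply: (@le_trans _ _ (\esum_(i in setT) v i)).
  have /card_esym/ppcard_eqP[f] := card_nat2.
  pose ab : (nat -> V) * (nat -> V) :=
    (fun k => (G (f k).1).1 (f k).2, fun k => (G (f k).1).2 (f k).2).
  have cab : box_cover (\bigcup_n A n) ab.
    move=> x [n _ /(PG n).1[j _ xj]].
    by exists (f^-1%FUN (n, j)) => //=; rewrite invK ?inE.
  apply: (le_trans (leb_measure_le cab)).
  have -> : (\sum_(0 <= i <oo) (boxvol (ab.1 i) (ab.2 i))%:E
     = \sum_(i <oo | xpredT i) v (f i))%E by [].
  rewrite -(esum_pred_image v _ xpredT) ?[fun=> _]set_true//.
  by rewrite image_eq.
rewrite (_ : esum _ _ = \sum_(i <oo) \sum_(j <oo ) v (i, j))%E; last first.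
  pose J : nat -> set (nat * nat) := fun i => [set (i, j) | j in setT].
  rewrite (_ : setT = \bigcup_k J k); last first.
    by rewrite predeqE => -[a b]; split => // _; exists a => //; exists b.
  rewrite esum_bigcupT /=; last 2 first.
    - apply/trivIsetP => i j _ _ ij.
      rewrite predeqE => -[n m] /=; split => //= -[] [_] _ [<-{n} _].
      by move=> [m' _] [] /esym/eqP; rewrite (negbTE ij).
    - by move=> /= [n m].
  rewrite -(image_id [set: nat]) -fun_true esum_pred_image//; last first.
    by move=> n _; exact: esum_ge0.
  apply: eq_eseriesr => /= j _.
  rewrite -(esum_pred_image v (pair j) predT)//=; last first.
    by move=> ? ? _ _; exact: (@can_inj _ _ _ snd).
  by congr esum; rewrite predeqE => -[a b]; split; move=> [i _ <-]; exists i.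
apply: lee_nneseries => [i _ _|i _]; first exact: nneseries_ge0.
exact: (PG i).2.
Qed.

HB.instance Definition _ := isOuterMeasure.Build R V (@leb_measure R d.+1)
  leb_measure0 leb_measure_ge0 leb_measure_mono leb_measure_sigma_subadditive.

Local Notation mu := (@leb_measure R d.+1).

Lemma boxvolD1 a b k : boxvol a b =
  Num.max (b 0 k - a 0 k) 0 * \prod_(j < d.+1 | j != k) Num.max (b 0 j - a 0 j) 0.
Proof. by rewrite /boxvol (bigD1 k). Qed.

(** Each box of a cover is cut along the hyperplane. The boxes are open, so the upper part must
    start slightly below [c] to keep the points on the hyperplane. The overlap [eta i] is chosen
    against the cross-section [W i], and the added volumes sum to at most [e]. *)
Lemma halfspace_caratheodory (k : 'I_d.+1) (c : R) :
  mu.-caratheodory [set x : V | x 0 k < c].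
Proof.
apply: le_caratheodory_measurable => X.
set H := [set x : V | x 0 k < c].
apply: le_ereal_inf_tmp => _ [[a b] Xab <-] /=.
apply/lee_addgt0Pr => e e0.
pose W i := \prod_(j < d.+1 | j != k) Num.max (b i 0 j - a i 0 j) 0.
have W0 i : 0 <= W i by apply: prodr_ge0 => j _; rewrite le_max lexx orbT.
pose eta i := e / (2 ^ i.+1)%:R / (W i + 1).
have eta0 i : 0 < eta i by rewrite !divr_gt0// ltr_wpDl.
pose b' i : V := \row_j if j == k then Num.min (b i 0 k) c else b i 0 j.
pose a' i : V := \row_j if j == k then Num.max (a i 0 k) (c - eta i) else a i 0 j.
have c1 : box_cover (X `&` H) (a, b').
  move=> x [/Xab[i _ xi] Hx]; exists i => // j; rewrite mxE.
  by case: eqP => [->|_]; [rewrite lt_min (andP (xi k)).1 (andP (xi k)).2|exact: xi].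
have c2 : box_cover (X `&` ~` H) (a', b).
  move=> x [/Xab[i _ xi] Hx]; exists i => // j; rewrite mxE.
  case: eqP => [->|_]; last exact: xi.
  rewrite gt_max (andP (xi k)).1 (andP (xi k)).2/= andbT.
  have cx : c <= x 0 k by rewrite leNgt; exact/negP.
  by rewrite ltrBlDr; apply: le_lt_trans cx _; rewrite ltrDl.
have := leeD (leb_measure_le c1) (leb_measure_le c2) => /le_trans; apply.
rewrite -nneseriesD; [|by move=> i _ _; rewrite lee_fin boxvol_ge0..].
apply: (@le_trans _ _ (\sum_(0 <= i <oo) ((boxvol (a i) (b i))%:E
    + (e / (2 ^ i.+1)%:R)%:E))%E); last first.
  by apply: epsilon_trick => [i|]; [rewrite lee_fin boxvol_ge0|exact: ltW].
apply: lee_nneseries => [i _ _|i _] /=; first by rewrite adde_ge0// lee_fin boxvol_ge0.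
rewrite -!EFinD lee_fin !(boxvolD1 _ _ k) -/(W i).
rewrite [X in _ * X + _](_ : _ = W i); last first.
  by apply: eq_bigr => j /negbTE jk; rewrite mxE jk.
rewrite [X in _ + _ * X](_ : _ = W i); last first.
  by apply: eq_bigr => j /negbTE jk; rewrite mxE jk.
rewrite !mxE eqxx -mulrDl.
apply: (@le_trans _ _ ((Num.max (b i 0 k - a i 0 k) 0 + eta i) * W i)).
  apply: ler_wpM2r => //; move: (eta0 i); move: (eta i) (a i 0 k) (b i 0 k) => h x y h0.
  rewrite /Num.max /Num.min; do ! case: ifPn => //; rewrite -?leNgt; lra.
have W1 : (W i + 1)^-1 * W i <= 1.
  by rewrite mulrC ler_pdivrMr ?mul1r ?lerDl// ltr_wpDl.
rewrite mulrDl lerD2l /eta -[leLHS]mulrA; apply: ler_piMr W1.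
by rewrite divr_ge0// ltW.
Qed.


Definition leb_measurable : set (set V) := mu.-cara.-measurable.

Lemma measurable_halfspaceN (k : 'I_d.+1) (c : R) :
  leb_measurable [set x : V | c < x 0 k].
Proof.
have -> : [set x : V | c < x 0 k] =
    ~` \bigcap_(n in [set: nat]) [set x : V | x 0 k < c + n.+1%:R^-1].
  apply/seteqP; split => x /=.
    move=> cx h; have : 0 < x 0 k - c by rewrite subr_gt0.
    move=> /ltr_add_invr[n]; rewrite add0r => hn.
    by have := h n I; rewrite /= -ltrBlDl => /(lt_trans hn); rewrite ltxx.
  move=> h; rewrite ltNge; apply/negP => xc; apply: h => n _ /=.
  by rewrite (le_lt_trans xc)// ltrDl invr_gt0.
apply: measurableC; apply: bigcap_measurable => //.
by move=> n _; exact: halfspace_caratheodory.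
Qed.

Lemma measurable_box a b : leb_measurable (box a b).
Proof.
rewrite (_ : box a b = \bigcap_(j in [set: 'I_d.+1])
   ([set x : V | a 0 j < x 0 j] `&` [set x | x 0 j < b 0 j])); last first.
  by apply/seteqP; split => x h j; [move=> _; split; case/andP: (h j)|
    case: (h j I) => /= -> ->].
apply: fin_bigcap_measurable => // j _; apply: measurableI.
  exact: measurable_halfspaceN.
exact: halfspace_caratheodory.
Qed.

Lemma ball_box c (r : R) : 0 < r ->
  ball c r = box (\row_j (c 0 j - r)) (\row_j (c 0 j + r)).
Proof.
move=> r0; apply/seteqP; split => x.
  by move=> [_ h] j; have := h 0 j; rewrite /ball/= !mxE -ltr_distl distrC.
move=> h; split=> // i j; rewrite ord1; have := h j.
by rewrite /ball/= !mxE -ltr_distl distrC.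
Qed.

Lemma measurable_ball c (r : R) : leb_measurable (ball c r).
Proof.
have [r0|r0] := ltP 0 r; first by rewrite ball_box//; exact: measurable_box.
rewrite (_ : ball c r = set0); first exact: measurable0.
by rewrite -subset0 => x [] /lt_le_trans => /(_ _ r0); rewrite ltxx.
Qed.

Definition rational_point (q : 'rV[rat]_d.+1) : V := map_mx ratr q.

Lemma rational_point_dense (x : V) (e : R) : 0 < e ->
  exists q, ball (rational_point q) e x.
Proof.
move=> e0; have h (j : 'I_d.+1) : exists q : rat, x 0 j - e < ratr q < x 0 j + e.
  have [|q] := @rat_in_itvoo R (x 0 j - e) (x 0 j + e); last by exists q.
  by rewrite ltrD2l gtrN.
exists (\row_j xchoose (h j)); split => // i j; rewrite ord1 !mxE /ball/=.
by rewrite ltr_distl; exact: xchooseP (h j).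
Qed.

(* A countable family of concentric balls with rational centers: the ball of
   radius [r/4] is counted only when the closed ball of radius [r] lies in the
   open set. *)
Definition rational_ball (G : set V) (k : nat) : V * R :=
  if (unpickle k : option ('rV[rat]_d.+1 * nat)) is Some qn then
    let c := rational_point qn.1 in let r := qn.2.+1%:R^-1 in
    if `[< [set x | `|x - c| <= r] `<=` G >] then (c, r) else (0, 0)
  else (0, 0).

Lemma rational_ball_sub G k : 0 < (rational_ball G k).2 ->
  [set x | `|x - (rational_ball G k).1| <= (rational_ball G k).2] `<=` G.
Proof.
rewrite /rational_ball; case: unpickle => [[q n]|]/=; rewrite ?ltxx//.
by case: asboolP => //=; rewrite ltxx.
Qed.

Lemma bigcup_rational_ball G : open G ->
  G = \bigcup_k ball (rational_ball G k).1 ((rational_ball G k).2 / 4).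
Proof.
move=> oG; apply/seteqP; split => x; last first.
  move=> [k _ kx]; have k0 : 0 < (rational_ball G k).2.
    by case: kx => + _; rewrite pmulr_lgt0.
  apply: (rational_ball_sub k0) => /=; move: kx.
  rewrite mx_norm_ball /ball_/= distrC => /ltW/le_trans; apply.
  by rewrite ler_pdivrMr// ler_peMr ?ltW//; lra.
move=> Gx; have /nbhs_ballP[e /= e0 eG] := open_nbhs_nbhs (conj oG Gx).
have [n ne] := ltr_add_invr (divr_gt0 e0 (ltr0n _ 2)).
rewrite add0r in ne.
set r : R := n.+1%:R^-1 in ne; have r0 : 0 < r by rewrite invr_gt0.
have [q qx] := rational_point_dense x (divr_gt0 r0 (ltr0n _ 4)).
exists (pickle (q, n)) => //.
rewrite /rational_ball pickleK; case: asboolP => //=; case=> y /= yq.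
apply: eG; move: qx; rewrite mx_norm_ball /ball_/= => qx.
rewrite distrC -(subrKA (rational_point q)) (le_lt_trans (ler_normD _ _))//.
rewrite -/r in yq; lra.
Qed.

Lemma measurable_open G : open G -> leb_measurable G.
Proof.
move=> /bigcup_rational_ball ->; apply: bigcup_measurable => k _.
exact: measurable_ball.
Qed.

Lemma measurable_closed F : closed F -> leb_measurable F.
Proof.
move=> cF; rewrite -(setCK F); apply: measurableC; apply: measurable_open.
exact: closed_openC.
Qed.

Lemma leb_measure_fin A : bounded_set A -> (mu A < +oo)%E.
Proof.
move=> [M [_ AM]]; pose r := M + 1.
pose ab : (nat -> V) * (nat -> V) :=
  (fun k => if k is 0 then const_mx (- (r + 1)) else 0,
   fun k => if k is 0 then const_mx (r + 1) else 0).
have h : box_cover A ab.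
  move=> x /(AM r _) xr; exists 0 => //= j; rewrite !mxE -ltr_norml.
  rewrite (@le_lt_trans _ _ r) ?ltrDl//; apply: le_trans (xr _); last by rewrite ltrDl.
  rewrite [leRHS]/Num.norm/= mx_normrE.
  exact: (le_bigmax _ (fun ij => `|x ij.1 ij.2|) (0, j)).
apply: (le_lt_trans (leb_measure_le h)).
rewrite (nneseries_split 0 1); last by move=> k _; rewrite lee_fin boxvol_ge0.
rewrite [X in (_ + X)%E]eseries0; last first.
  by move=> [//|k] _ _ /=; rewrite boxvol0.
by rewrite big_nat1/= adde0 ltey.
Qed.

Lemma leb_measure_translate A (v : V) : mu [set x | A (x + v)] = mu A.
Proof.
suff le B w : (mu [set x | B (x + w)%R] <= mu B)%E.
  apply/eqP; rewrite eq_le le/=.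
  rewrite [X in (mu X <= _)%E](_ : A = [set x | [set y | A (y + v)] (x - v)]).
    exact: le.
  by apply/seteqP; split => x /=; rewrite subrK.
apply: le_ereal_inf_tmp => _ [[a b] Bab <-].
have h : box_cover [set x | B (x + w)] (fun k => a k - w, fun k => b k - w).
  move=> x /= /Bab[k _ kx]; exists k => // j; have := kx j.
  by rewrite /= !mxE ltrBlDr ltrBrDr.
apply: (le_trans (leb_measure_le h)); rewrite le_eqVlt; apply/orP; left; apply/eqP.
apply: eq_eseriesr => k _; congr _%:E; apply: eq_bigr => j _ /=.
by rewrite !mxE; congr Num.max; ring.
Qed.

End OuterMeasure.

Lemma bounded_setP (R : realType) (W : normedModType R) (A : set W) :
  bounded_set A <-> exists M, forall x, A x -> `|x| <= M.
Proof.
split=> [[M [_ AM]]|[M AM]].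
  by exists (M + 1) => x /(AM (M + 1)); apply; rewrite ltrDl.
exists M; split; first exact: num_real.
by move=> y /ltW My x /AM /le_trans; apply.
Qed.

Lemma sub_bounded_set (R : realType) (W : normedModType R) (A B : set W) :
  A `<=` B -> bounded_set B -> bounded_set A.
Proof. by move=> AB /bounded_setP[M BM]; apply/bounded_setP; exists M => x /AB/BM. Qed.

(** * Real-valued volume: exhaustion by balls and the strip estimate *)

Section Volume.
Variables (R : realType) (d : nat).
Local Notation V := 'rV[R]_d.+1.
Implicit Types (A B G O : set V).
Local Notation mu := (@leb_measure R d.+1).

Let leb_outer : {outer_measure set V -> \bar R} := mu.

Let leb_meas : {measure set (caratheodory_type leb_outer) -> \bar R} :=
  (leb_outer : set (caratheodory_type leb_outer) -> \bar R).

(** Real values make real arithmetic available. On bounded sets nothing is lost, by [volE]; an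
    infinite measure is sent to 0. *)
Definition vol A : R := fine (leb_measure A).

Lemma volE A : bounded_set A -> leb_measure A = (vol A)%:E.
Proof. by move=> bA; rewrite fineK// ge0_fin_numE ?leb_measure_ge0 ?leb_measure_fin. Qed.

Lemma vol_ge0 A : 0 <= vol A.
Proof. by rewrite fine_ge0 ?leb_measure_ge0. Qed.

Lemma le_vol A B : bounded_set B -> A `<=` B -> vol A <= vol B.
Proof.
move=> bB AB; rewrite -lee_fin -!volE//; last exact: sub_bounded_set bB.
exact: leb_measure_mono.
Qed.

Lemma vol0 : vol set0 = 0.
Proof. by rewrite /vol leb_measure0. Qed.

Lemma vol_setU A B : bounded_set (A `|` B) -> leb_measurable A -> leb_measurable B ->
  A `&` B = set0 -> vol (A `|` B) = vol A + vol B.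
Proof.
move=> bAB mA mB AB0.
have bA : bounded_set A by apply: sub_bounded_set bAB => x; left.
have bB : bounded_set B by apply: sub_bounded_set bAB => x; right.
apply: EFin_inj; rewrite EFinD -!volE//.
have := @measureU _ _ _ leb_meas A B.
by apply.
Qed.

Lemma vol_bigcup (F : nat -> set V) B n : bounded_set B ->
  (forall k, leb_measurable (F k)) -> (forall k, F k `<=` B) ->
  (forall j k x, (j < n)%N -> (k < n)%N -> F j x -> F k x -> j = k) ->
  vol [set x | exists2 k, (k < n)%N & F k x] = \sum_(k < n) vol (F k).
Proof.
move=> bB mF FB; elim: n => [|n IH] dF.
  by rewrite big_ord0 (_ : mkset _ = set0) ?vol0// -subset0 => x [].
rewrite big_ord_recr/= -IH; last first.
  by move=> j k x jn kn; apply: dF; exact: ltnW.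
rewrite -vol_setU//.
- congr vol; apply/seteqP; split => x /=.
    move=> [k]; rewrite ltnS leq_eqVlt => /predU1P[->|kn Fk]; first by right.
    by left; exists k.
  by move=> [[k kn Fk]|Fn]; [exists k => //; exact: ltnW|exists n].
- by apply: sub_bounded_set bB => x [[k _]|]; exact: FB.
- rewrite (_ : mkset _ = \bigcup_(k in `I_n) F k); last first.
    by apply/seteqP; split => x [k kn Fk]; exists k.
  by apply: fin_bigcup_measurable => // k _; exact: mF.
- rewrite -subset0 => x [[k kn Fk] Fn].
  by have := dF _ _ _ (ltnW kn) (ltnSn n) Fk Fn; move: kn => /[swap] ->; rewrite ltnn.
Qed.

Lemma vol_translate A v : vol [set x | A (x + v)] = vol A.
Proof. by rewrite /vol leb_measure_translate. Qed.

(** An open set is the increasing union of finite unions of its rational balls, so continuity from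
    below applies. Only the quarter balls are counted while the full closed balls stay in [G]: the
    gap leaves room for a cutoff. *)
Lemma inner_balls G (e : R) : open G -> bounded_set G -> 0 < e ->
  exists s : seq (V * R),
    (forall z, z \in s -> 0 < z.2 /\ [set x | `|x - z.1| <= z.2] `<=` G) /\
    (1 - e) * vol G <= vol [set x | exists2 z, z \in s & ball z.1 (z.2 / 4) x].
Proof.
move=> oG bG e0.
have [vG0|vG0] := eqVneq (vol G) 0.
  by exists [::]; split => //; rewrite vG0 mulr0 vol_ge0.
pose F n := [set x | exists2 k, (k < n)%N &
  ball (rational_ball G k).1 ((rational_ball G k).2 / 4) x].
have FE n : F n = \bigcup_(k in `I_n)
    ball (rational_ball G k).1 ((rational_ball G k).2 / 4).
  by apply/seteqP; split => x [k kn Fk]; exists k.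
have mF n : leb_measurable (F n).
  by rewrite FE; apply: fin_bigcup_measurable => // k _; exact: measurable_ball.
have FG : \bigcup_n F n = G.
  rewrite [RHS](bigcup_rational_ball oG); apply/seteqP; split => x.
    by move=> [n _ [k kn Fk]]; exists k.
  by move=> [k _ Fk]; exists k.+1 => //; exists k.
have ndF : nondecreasing_seq F.
  move=> n p np; apply/subsetPset => x [k kn Fk]; exists k => //.
  exact: leq_trans np.
have bF n : bounded_set (F n).
  by apply: sub_bounded_set bG; rewrite -FG => x Fx; exists n.
have cF : mu \o F @ \oo --> mu (\bigcup_n F n).
  apply: (@nondecreasing_cvg_mu _ _ _ leb_meas) => //.
  by rewrite FG; exact: measurable_open.
have [n hn] : exists n, (1 - e) * vol G <= vol (F n).
  apply: contrapT => /forallNP h.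
  have : (lim (mu \o F @ \oo) <= ((1 - e) * vol G)%:E)%E.
    apply: lime_le; first by apply/cvg_ex; eexists; exact: cF.
    apply: nearW => n /=; rewrite volE// lee_fin ltW// ltNge.
    exact/negP/h.
  rewrite (cvg_lim _ cF)// FG volE// lee_fin.
  have : 0 < vol G by rewrite lt_def vG0 vol_ge0.
  by move=> ? ?; nra.
exists [seq z <- [seq rational_ball G k | k <- iota 0 n] | 0 < z.2]; split.
  move=> z; rewrite mem_filter => /andP[z0 /mapP[k _ zE]]; split=> //.
  by move: z0; rewrite zE; exact: rational_ball_sub.
apply: (le_trans hn); rewrite le_eqVlt; apply/orP; left; apply/eqP.
congr vol; apply/seteqP; split => x /=.
  move=> [k kn kx]; exists (rational_ball G k) => //.
  rewrite mem_filter; apply/andP; split.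
    by case: kx => + _; rewrite pmulr_lgt0.
  by apply/mapP; exists k => //; rewrite mem_iota.
move=> [z]; rewrite mem_filter => /andP[_ /mapP[k + ->]].
by rewrite mem_iota => /andP[_ kn]; exists k.
Qed.

(* Cut [R^d] into [M] families of strips that are translates of one another:
   each family meets [O] in at least [1/M] of the volume of [O']. *)
Lemma vol_strips (s : V -> R) (v : V) O O' (L : R) : continuous s ->
  (forall (x : V) (t : R), s (x + t *: v) = s x + t) ->
  open O -> bounded_set O -> open O' ->
  (forall (x : V) (t : R), O' x -> `|t| <= 1 -> O (x + t *: v)) -> 0 <= L <= 1 ->
  L * vol O' <= vol (O `&` [set x | exists z : int, 0 < s x - z%:~R < L]).
Proof.
move=> cs sv oO bO oO' O'O /andP[L0 L1].
set S := _ `&` _.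
have O'sub : O' `<=` O by move=> x /O'O h; have := h 0; rewrite normr0 scale0r addr0; apply.
have bO' : bounded_set O' by exact: sub_bounded_set bO.
have bS : bounded_set S by apply: sub_bounded_set bO => x [].
(* With [m.+1] classes of thin strips, rounding costs the share of at most two classes; then [m]
   grows. *)
suff h m : (L - 2 / m.+1%:R) * vol O' <= vol S.
  have [v0|v0] := eqVneq (vol O') 0; first by rewrite v0 mulr0 vol_ge0.
  have {}v0 : 0 < vol O' by rewrite lt_def v0 vol_ge0.
  apply/ler_addgt0Pr => e e0.
  have [m] := ltr_add_invr (divr_gt0 e0 (mulr_gt0 (ltr0n _ 2) v0)).
  rewrite add0r ltr_pdivlMr ?mulr_gt0// => hm.
  have := h m; move: hm; move: (m.+1%:R^-1) (vol O') (vol S) => q a b; nra.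
set M := m.+1; have M0 : (0 : R) < M%:R by rewrite ltr0n.
have Mz : (M%:Z != 0)%R by [].
(* [f] numbers the strips of width [1 / M] in the variable [s]; [T j] collects those whose number is
   [j] modulo [M]. *)
pose f x := Num.floor (M%:R * s x).
pose T (j : nat) := [set x | (f x %% M)%Z = j].
have mf z : leb_measurable [set x | f x = z].
  have -> : [set x | f x = z] =
      (fun x => M%:R * s x) @^-1` [set y | z%:~R <= y] `&`
      (fun x => M%:R * s x) @^-1` [set y | y < (z + 1)%:~R].
    apply/seteqP; split => x /=.
      by move=> <-; rewrite floor_le floorD1_gt.
    by move=> [h1 h2]; apply: floor_def; rewrite h1 h2.
  have cMs : continuous (fun x => M%:R * s x).
    by move=> x; exact: cvgMl_tmp (cs x).
  apply: measurableI.
    apply: measurable_closed.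
    by move/continuous_closedP : cMs; apply; exact: closed_ge.
  apply: measurable_open.
  by move/continuousP : cMs; apply; exact: open_lt.
have mT j : leb_measurable (T j).
  rewrite (_ : T j = \bigcup_(z : int)
      (if (z %% M)%Z == j then [set x | f x = z] else set0)); last first.
    apply/seteqP; split => x /= => [Tx|[z _]].
      by exists (f x) => //; rewrite Tx eqxx.
    by case: eqP => // zj /= fz; rewrite /T/= fz.
  apply: countable_bigcupT_measurable => // z.
  by case: ifP => _; [exact: mf|exact: measurable0].
(* A shift by [(j - k) / M] along [v] carries class [k] onto class [j], and [O'O] keeps the shifted
   [O'] inside [O]. *)
have le_DE j k : (j < M)%N -> (k < M)%N -> vol (O' `&` T j) <= vol (O `&` T k).
  move=> jM kM; pose t : R := (j%:R - k%:R) / M%:R.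
  rewrite -(vol_translate (O' `&` T j) (t *: v)); apply: le_vol.
    by apply: sub_bounded_set bO => x [].
  move=> x /= [px Tx]; split.
    have := O'O _ (- t) px; rewrite scaleNr addrK; apply.
    rewrite normrN normrM normfV [`|M%:R|]ger0_norm ?ler0n// ler_pdivrMr// mul1r.
    have : (j%:R : R) < M%:R by rewrite ltr_nat.
    have : (k%:R : R) < M%:R by rewrite ltr_nat.
    have : (0 : R) <= k%:R by []. have : (0 : R) <= j%:R by [].
    by move=> *; rewrite ler_norml; lra.
  move: Tx; rewrite /T/= /f sv mulrDr mulrCA divff ?gt_eqF// mulr1.
  have -> : j%:R - k%:R = (j%:Z - k%:Z)%:~R :> R by rewrite rmorphB.
  rewrite floorDrz ?intr_int// intrKfloor => h.
  rewrite (_ : Num.floor _ = Num.floor (M%:R * s x) + (j%:Z - k%:Z) + (k%:Z - j%:Z)).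
    by rewrite -modzDml h addrC subrK modz_small.
  by rewrite -addrA (_ : _ - _ + _ = 0) ?addr0//; ring.
have O'E : O' = [set x | exists2 k, (k < M)%N & (O' `&` T k) x].
  apply/seteqP; split => x /=; last by case=> k _ [].
  move=> px; exists `|(f x %% M)%Z|%N.
    rewrite -ltz_nat gez0_abs ?modz_ge0//. exact: ltz_pmod.
  by split=> //; rewrite /T/= gez0_abs// modz_ge0.
have T_inj j k x : T j x -> T k x -> j = k.
  by rewrite /T/= => -> [].
have mO'T j : leb_measurable (O' `&` T j).
  by apply: measurableI (mT j); exact: measurable_open.
have mOT j : leb_measurable (O `&` T j).
  by apply: measurableI (mT j); exact: measurable_open.
have leO' k : (k < M)%N -> vol O' <= M%:R * vol (O `&` T k).
  move=> kM; rewrite [in leLHS]O'E (vol_bigcup bO') => [|j|j x []//|]; last 2 first.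
  - exact: mO'T.
  - by move=> i j x _ _ [_ Ti] [_ Tj]; exact: T_inj Ti Tj.
  apply: (@le_trans _ _ (\sum_(j < M) vol (O `&` T k))).
    by apply: ler_sum => j _; exact: le_DE.
  by rewrite sumr_const card_ord mulr_natl.
have /truncn_itv/andP[K1 K2] : 0 <= L * M%:R by rewrite mulr_ge0// ltW.
set K := Num.truncn _ in K1 K2.
have KM : (K <= M)%N by rewrite -(ler_nat R) (le_trans K1)// ler_piMl// ltW.
(* Classes [1] to [K - 1] lie in the wide strips. Class [0] is left out: it may contain points where
   [s] is an integer, and there the strict lower bound fails. *)
have sumS : \sum_(k < K.-1) vol (O `&` T k.+1) <= vol S.
  rewrite -(@vol_bigcup (fun k => O `&` T k.+1) O _ bO) => [|k|k x []//|]; last 2 first.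
  - exact: mOT.
  - by move=> i j x _ _ [_ Ti] [_ Tj]; apply: succn_inj; exact: T_inj Ti Tj.
  apply: le_vol => // x [k kK [Ox Tx]]; split => //.
  exists (f x %/ M)%Z.
  have /andP[] := floor_itv (M%:R * s x); rewrite -/(f x) {1 2}(divz_eq (f x) M) Tx.
  rewrite !rmorphD !rmorphM/= => h1 h2.
  have : (k.+2%:R : R) <= L * M%:R.
    apply: le_trans K1; rewrite ler_nat; move: kK; by case: (K).
  rewrite -(ltr_pM2r M0) mul0r -[_ < L](ltr_pM2r M0) mulrBl.
  move: h1 h2; rewrite -!pmulrn -!natr1; set q := (_ %/ _)%Z%:~R.
  have : (0 : R) <= k%:R by [].
  by move=> *; lra.
apply: le_trans sumS; apply: (@le_trans _ _ (\sum_(k < K.-1) (vol O' / M%:R))).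
  rewrite sumr_const card_ord -[leRHS]mulr_natl mulrCA [leLHS]mulrC.
  apply: ler_wpM2l; first exact: vol_ge0.
  rewrite ler_pdivlMr// mulrBl divfK ?gt_eqF//.
  have : (K%:R : R) - 1 <= K.-1%:R.
    by case: (K) => [|k]; rewrite /= -?natr1 ?addrK// ?sub0r lerN10.
  by move: K2; rewrite -natr1; lra.
apply: ler_sum => k _; rewrite ler_pdivrMr// mulrC; apply: leO'.
apply: leq_trans KM; case: k => k /=; by case: (K).
Qed.

End Volume.

(** * One-dimensional profiles *)

Section RealLine.
Variable R : realType.
Implicit Types (f g P : R -> R) (x y : R).

Lemma is_derive_continuous f x df : is_derive x (1 : R) f df -> {for x, continuous f}.
Proof. by move=> [df_ex _]; apply/differentiable_continuous/derivable1_diffP. Qed.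

Lemma mean_value f df (a b : R) : a < b ->
  (forall x, is_derive x (1 : R) f (df x)) ->
  exists2 c, a < c < b & f b - f a = df c * (b - a).
Proof.
move=> ab hf; have cf : {within `[a, b], continuous f}.
  by apply: continuous_subspaceT => x; exact: is_derive_continuous (hf x).
have [c] := MVT ab (fun x _ => hf x) cf.
by rewrite in_itv/=; exists c.
Qed.

(** The signed integral from 0 serves both half-lines. Near [x] it differs by a constant from the
    integral starting at a point [a] below both [x] and 0, to which the fundamental theorem
    applies. *)
Lemma primitive_exists f : continuous f ->
  exists P, forall x, is_derive x (1 : R) P (f x).
Proof.
move=> cf; pose mu := @lebesgue_measure R.
pose F (a x : R) := (\int[mu]_(t in [set` `[a, x]]) f t)%R.
pose P x := if 0 <= x then (\int[mu]_(t in [set` `]0, x]%R]) f t)%R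
            else - (\int[mu]_(t in [set` `]x, 0]%R]) f t)%R.
have intf (a b : R) : mu.-integrable [set` `[a, b]%R] (EFin \o f).
  apply: continuous_compact_integrable; first exact: segment_compact.
  exact: continuous_subspaceT.
have PE a x : a <= x -> a <= 0 -> P x = F a x - F a 0.
  move=> ax a0; rewrite /P; case: leP => x0.
    by rewrite /F Rintegral_itvB.
  by rewrite -[RHS]opprB /F Rintegral_itvB//; apply: ltW.
exists P => x; pose a := Num.min x 0 - 1.
have ax : a < x by rewrite ltrBlDr gt_min ltrDl ltr01.
have a0 : a < 0 by rewrite ltrBlDr gt_min orbC add0r ltr01.
have [dF F'] : derivable (F a) x 1 /\ (F a)^`() x = f x.
  have xx1 : x < x + 1 by rewrite ltrDl.
  apply: (@continuous_FTC1 R f (BLeft a) x (x + 1) xx1 (intf a (x + 1)) _ (cf x)).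
  by rewrite /= lte_fin.
have hF : is_derive x (1 : R) (fun y => F a y - F a 0) (f x).
  have hF0 : is_derive x (1 : R) (F a) (f x).
    by apply: DeriveDef => //; rewrite -derive1E.
  have := is_deriveB hF0 (is_derive_cst (F a 0) x (1 : R)).
  by rewrite subr0.
apply: near_eq_is_derive hF; near=> y; rewrite (PE a) ?(ltW a0)// ltW//.
by near: y; exact: lt_nbhsr.
Unshelve. all: by end_near. Qed.

(** A smooth function carried together with all its derivatives: smoothness is data, and
    differentiating is a shift of the index. *)
Record jet := Jet {
  jet_fun :> nat -> R -> R;
  jet_derive : forall k x, is_derive x (1 : R) (jet_fun k) (jet_fun k.+1 x) }.

Lemma jet_continuous (j : jet) k : continuous (j k).
Proof. by move=> x; exact: is_derive_continuous (jet_derive j k x). Qed.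

Lemma jet_prim (j : jet) : exists p : jet, forall k, p k.+1 = j k.
Proof.
have [P hP] := primitive_exists (@jet_continuous j 0).
have h k x : is_derive x (1 : R) ((fun k => if k is k'.+1 then j k' else P) k)
    ((fun k => if k is k'.+1 then j k' else P) k.+1 x).
  by case: k => [|k] /=; [exact: hP|exact: jet_derive].
by exists (Jet h).
Qed.

Lemma is_derive_affine f (a b x : R) df : is_derive (a * x + b) (1 : R) f df ->
  is_derive x (1 : R) (fun y => f (a * y + b)) (a * df).
Proof.
move=> hf.
have h : is_derive x (1 : R) (fun y => a * y + b) a.
  have := is_deriveD (is_deriveZ a (is_derive_id x (1 : R))) (is_derive_cst b x (1 : R)).
  by rewrite addr0 /GRing.scale/= mulr1.
by have := @is_derive1_comp R f (fun y => a * y + b) x _ _ hf h; rewrite mulrC.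
Qed.

Lemma jet_comp_affine (j : jet) (c a b : R) :
  exists p : jet, forall k x, p k x = c * a ^+ k * j k (a * x + b).
Proof.
have h k x : is_derive x (1 : R) ((fun k x => c * a ^+ k * j k (a * x + b)) k)
    ((fun k x => c * a ^+ k * j k (a * x + b)) k.+1 x).
  have := is_deriveZ (c * a ^+ k) (is_derive_affine (jet_derive j k (a * x + b))).
  by rewrite /= exprSr !mulrA /GRing.scale/= !mulrA.
by exists (Jet h).
Qed.

Lemma jet_add (j1 j2 : jet) : exists p : jet, forall k x, p k x = j1 k x + j2 k x.
Proof.
have h k x : is_derive x (1 : R) ((fun k x => j1 k x + j2 k x) k)
    ((fun k x => j1 k x + j2 k x) k.+1 x).
  exact: is_deriveD (jet_derive j1 k x) (jet_derive j2 k x).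
by exists (Jet h).
Qed.

Lemma jet_line (a b : R) : exists p : jet,
  [/\ forall x, p 0 x = a * x + b, forall x, p 1 x = a &
      forall k x, p k.+2 x = 0].
Proof.
pose F k (x : R) := match k with 0 => a * x + b | 1 => a | _ => 0 end.
have h k x : is_derive x (1 : R) (F k) (F k.+1 x).
  case: k => [|[|k]]; [|exact: is_derive_cst|exact: is_derive_cst].
  have := is_deriveD (is_deriveZ a (is_derive_id x (1 : R))) (is_derive_cst b x (1 : R)).
  by rewrite addr0 /GRing.scale/= mulr1.
by exists (Jet h).
Qed.

(* Leibniz rule: [(k, l)] in the list stands for [f^(k) g^(l)]. *)
Lemma jet_mul (f g : jet) : exists p : jet, forall x, p 0 x = f 0 x * g 0 x.
Proof.
pose ev (s : seq (nat * nat)) x := \sum_(p <- s) f p.1 x * g p.2 x.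
pose D (s : seq (nat * nat)) :=
  [seq (p.1.+1, p.2) | p <- s] ++ [seq (p.1, p.2.+1) | p <- s].
have evD s x : is_derive x (1 : R) (ev s) (ev (D s) x).
  rewrite /ev /D big_cat !big_map /= -big_split/=; elim: s => [|p s IH].
    rewrite big_nil (_ : (fun _ => _) = cst 0); last first.
      by apply/funext => y; rewrite big_nil.
    exact: is_derive_cst.
  rewrite big_cons (_ : (fun _ => _) = (fun y => f p.1 y * g p.2 y) +
    (fun y => \sum_(q <- s) f q.1 y * g q.2 y)); last first.
    by apply/funext => y; rewrite big_cons.
  apply: is_deriveD.
  have hM := is_deriveM (jet_derive f p.1 x) (jet_derive g p.2 x).
  by apply: (is_derive_eq hM); rewrite /GRing.scale/=; ring.
have h k x : is_derive x (1 : R) ((fun k => ev (iter k D [:: (0, 0)])) k)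
    ((fun k => ev (iter k D [:: (0, 0)])) k.+1 x) by exact: evD.
by exists (Jet h) => x; rewrite /= /ev big_seq1.
Qed.

End RealLine.

(** * Flat function, smooth steps, plateaus and periodization *)

Section Bumps.
Variable R : realType.

(** Termwise from $y^i\le i!\,e^y$, the origin of the factorials. *)
Lemma horner_expRN_bounded (p : {poly R}) :
  exists2 C, 0 <= C & forall y, 0 < y -> `|p.[y]| * expR (- y) <= C.
Proof.
exists (\sum_(i < size p) `|p`_i| * i`!%:R) => [|y y0].
  by apply: sumr_ge0 => i _; rewrite mulr_ge0.
rewrite expRN ler_pdivrMr ?expR_gt0// horner_coef (le_trans (ler_norm_sum _ _ _))//.
rewrite mulr_suml; apply: ler_sum => i _.
rewrite normrM -mulrA ler_wpM2l// normrX gtr0_norm//.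
rewrite mulrC -ler_pdivrMr ?ltr0n ?fact_gt0//.
case: (val i) => [|k]; first by rewrite expr0 fact0 divr1; have := expR_ge1Dx y; lra.
by have := expR_ge1Dxn k (ltW y0); lra.
Qed.

(** With $y=1/x$, the derivative of $P(y)e^{-y}$ in $x$ is $y^2(P-P')(y)e^{-y}$. Thus [flat_fun k]
    is the [k]-th derivative of $e^{-1/x}$, extended by 0 to $x\le0$. *)
Fixpoint flat_poly (k : nat) : {poly R} :=
  if k is k'.+1 then 'X^2 * (flat_poly k' - (flat_poly k')^`()) else 1.

Definition flat_fun k (x : R) : R :=
  if 0 < x then (flat_poly k).[x^-1] * expR (- x^-1) else 0.

(** A bound of second order at 0 forces the difference quotients there to tend to 0, at every order
    [k]. *)
Lemma flat_fun_sqr k : exists2 C, 0 <= C & forall x, `|flat_fun k x| <= C * x ^+ 2.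
Proof.
have [C C0 hC] := horner_expRN_bounded ('X^2 * flat_poly k); exists C => // x.
rewrite /flat_fun; case: ifPn => x0; last by rewrite normr0 mulr_ge0// sqr_ge0.
rewrite normrM [`|expR _|]ger0_norm ?expR_ge0// -ler_pdivrMr ?exprn_gt0//.
apply: le_trans (hC x^-1 _); last by rewrite invr_gt0.
rewrite hornerM hornerXn normrM [`|_ ^+ 2|]ger0_norm ?sqr_ge0//.
by rewrite exprVn le_eqVlt; apply/orP; left; apply/eqP; ring.
Qed.

Lemma is_derive_flat_fun k x : is_derive x (1 : R) (flat_fun k) (flat_fun k.+1 x).
Proof.
have [x0|x0|->] := ltgtP x 0.
- rewrite (_ : flat_fun k.+1 x = 0); last by rewrite /flat_fun ltNge ltW.
  apply: (@near_eq_is_derive _ _ _ (cst 0)).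
  near=> y; rewrite /flat_fun ltNge ltW//=.
  by near: y; exact: lt_nbhsl.
- have hV : is_derive x (1 : R) (fun y => y^-1) (- x ^- 2).
    by have := @is_deriveV R id x 1 1 (lt0r_neq0 x0) (is_derive_id _ _); rewrite /GRing.scale/= mulr1.
  have hp := @is_derive1_comp R (horner (flat_poly k)) (fun y => y^-1) x _ _
    (is_derive_poly (flat_poly k) x^-1) hV.
  have he := @is_derive1_comp R expR (fun y => - y^-1) x _ _
    (is_derive_expR (- x^-1)) (is_deriveN hV).
  have hM := is_deriveM hp he.
  apply: (@near_eq_is_derive _ _ _ ((horner (flat_poly k) \o (fun y => y^-1)) \*
     (expR \o (fun y => - y^-1)))).
    near=> y; rewrite /flat_fun ifT//=.
    by near: y; exact: lt_nbhsr.
  apply: (is_derive_eq hM); rewrite /flat_fun x0 /GRing.scale/=.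
  by rewrite hornerM hornerD hornerN hornerXn exprVn; ring.
- rewrite (_ : flat_fun k.+1 0 = 0); last by rewrite /flat_fun ltxx.
  apply/is_derive1_caratheodory; exists (fun z => flat_fun k z / z).
  have f0 : flat_fun k 0 = 0 by rewrite /flat_fun ltxx.
  split; last by rewrite invr0 mulr0.
    move=> z; rewrite f0 !subr0; have [->|z0] := eqVneq z 0.
      by rewrite f0 mulr0.
    by rewrite divfK.
  have [C C0 hC] := flat_fun_sqr k.
  apply/cvgrPdist_lt => e e0.
  have eC0 : 0 < e / (C + 1) by rewrite divr_gt0// ltr_wpDl.
  near=> z; rewrite invr0 mulr0 sub0r normrN normrM normfV.
  have [->|z0] := eqVneq z 0; first by rewrite normr0 invr0 mulr0.
  rewrite ltr_pdivrMr ?normr_gt0//; apply: le_lt_trans (hC z) _.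
  rewrite -real_normK ?num_real// expr2 mulrA ltr_pM2r ?normr_gt0//.
  have : `|z| < e / (C + 1).
    near: z; apply/nbhs_ballP; exists (e / (C + 1)) => //= y.
    by rewrite /ball/= sub0r normrN.
  rewrite ltr_pdivlMr ?ltr_wpDl// => h; apply: le_lt_trans h.
  by rewrite mulrC ler_wpM2l// lerDl.
Unshelve. all: by end_near. Qed.

Definition flat_jet : jet R := Jet is_derive_flat_fun.

Lemma flat_jet_gt0 x : 0 < x -> 0 < flat_jet 0 x.
Proof. by move=> x0; rewrite /= /flat_fun x0 /= hornerC mul1r expR_gt0. Qed.

Lemma flat_jet_le0 x : x <= 0 -> flat_jet 0 x = 0.
Proof. by move=> x0; rewrite /= /flat_fun ltNge x0. Qed.

(** [S] is the normalized primitive of the product of the flat functions of [x] and [1 - x]. This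
    product is nonnegative and vanishes off the open unit interval, so the primitive is monotone and
    constant on either side. *)
Lemma step_exists : exists S : jet R,
  [/\ forall x, x <= 0 -> S 0 x = 0, forall x, 1 <= x -> S 0 x = 1 &
      forall x y, x <= y -> S 0 x <= S 0 y].
Proof.
have [r hr] := jet_comp_affine flat_jet 1 (-1) 1.
have [b hb] := jet_mul flat_jet r.
have [P hP] := jet_prim b.
have bE x : b 0 x = flat_jet 0 x * flat_jet 0 (1 - x).
  by rewrite hb hr expr0 !mul1r mulN1r addrC.
have fge0 x : 0 <= flat_jet 0 x.
  by have [/flat_jet_le0->//|/flat_jet_gt0/ltW] := leP x 0.
have b0 x : 0 <= b 0 x by rewrite bE mulr_ge0.
have dP x : is_derive x (1 : R) (P 0) (b 0 x) by rewrite -hP; exact: jet_derive.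
have ndP x y : x <= y -> P 0 x <= P 0 y.
  rewrite le_eqVlt => /predU1P[->//|xy].
  have [c _ h] := mean_value xy dP.
  by rewrite -subr_ge0 h mulr_ge0// subr_ge0 ltW.
have Pcst x y : x < y -> (forall c, x < c < y -> b 0 c = 0) -> P 0 y = P 0 x.
  move=> xy h; have [c /h c0 hc] := mean_value xy dP.
  by apply/eqP; rewrite -subr_eq0 hc c0 mul0r.
have I0 : 0 < P 0 1 - P 0 0.
  have [c /andP[c0 c1] ->] := mean_value ltr01 dP.
  by rewrite subr0 mulr1 bE mulr_gt0// flat_jet_gt0// subr_gt0.
have [L [hL _ _]] := jet_line 0 (- P 0 0 / (P 0 1 - P 0 0)).
have [Q hQ] := jet_comp_affine P (P 0 1 - P 0 0)^-1 1 0.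
have [S hS] := jet_add Q L.
have SE x : S 0 x = (P 0 x - P 0 0) / (P 0 1 - P 0 0).
  by rewrite hS hQ hL expr0 mulr1 mul1r addr0 mul0r add0r mulrC -mulrDl.
exists S; split=> [x x0|x x1|x y xy].
- rewrite SE; move: x0; rewrite le_eqVlt => /predU1P[->|x0].
    by rewrite subrr mul0r.
  rewrite (Pcst _ _ x0) ?subrr ?mul0r// => c /andP[_ c0].
  by rewrite bE flat_jet_le0 ?mul0r// ltW.
- rewrite SE; move: x1; rewrite le_eqVlt => /predU1P[<-|x1].
    by rewrite divff// gt_eqF.
  rewrite (Pcst _ _ x1) ?divff ?gt_eqF// => c /andP[c1 _].
  by rewrite bE (@flat_jet_le0 (1 - c)) ?mulr0// subr_le0 ltW.
- by rewrite !SE ler_pM2r ?invr_gt0// lerD2r ndP.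
Qed.

(** The difference of two steps of width [t], one rising from [-1] to [t - 1], the other from
    [1 - t] to [1]. *)
Lemma plateau_exists (t : R) : 0 < t <= 1 -> exists b : jet R,
  [/\ forall x, 0 <= b 0 x <= 1, forall x, `|x| <= 1 - t -> b 0 x = 1 &
      forall x, 1 <= `|x| -> b 0 x = 0].
Proof.
move=> /andP[t0 t1]; have [S [S0 S1 ndS]] := step_exists.
have Sle1 x : 0 <= S 0 x <= 1.
  apply/andP; split.
    have [x0|x0] := leP x 0; first by rewrite S0.
    by rewrite -(S0 0)// ndS// ltW.
  have [x1|x1] := leP 1 x; first by rewrite S1.
  by rewrite -(S1 1)// ndS// ltW.
have [p hp] := jet_comp_affine S 1 t^-1 t^-1.
have [q hq] := jet_comp_affine S (-1) t^-1 (- (1 - t) / t).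
have [b hb] := jet_add p q.
have bE x : b 0 x = S 0 ((x + 1) / t) - S 0 ((x - (1 - t)) / t).
  rewrite hb hp hq !expr0 !mulr1 !mul1r mulN1r; congr (S 0 _ - S 0 _); ring.
have le1 x : x <= 1 - t -> S 0 ((x - (1 - t)) / t) = 0.
  by move=> xt; rewrite S0// pmulr_lle0 ?invr_gt0// subr_le0.
have ge1 x : t - 1 <= x -> S 0 ((x + 1) / t) = 1.
  by move=> xt; rewrite S1// ler_pdivlMr// mul1r -lerBlDr.
exists b; split=> x.
- rewrite bE; have [xt|xt] := leP x (1 - t); first by rewrite le1// subr0.
  rewrite ge1; last lra.
  by have := Sle1 ((x - (1 - t)) / t); lra.
- by rewrite ler_norml => /andP[h1 h2]; rewrite bE le1// ge1 ?subr0//; lra.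
- rewrite bE ler_normr => /orP[x1|x1].
    rewrite ge1 ?S1 ?subrr//; last lra.
    by rewrite ler_pdivlMr//; lra.
  rewrite le1 ?S0 ?subrr//; last lra.
  by rewrite pmulr_lle0 ?invr_gt0//; lra.
Qed.

Lemma jet_zero_open (j : jet R) (U : set R) : open U ->
  (forall x, U x -> j 0 x = 0) -> forall k x, U x -> j k x = 0.
Proof.
move=> oU U0; elim=> // k IH x Ux.
have h : is_derive x (1 : R) (j k) 0.
  apply: (@near_eq_is_derive _ _ _ (cst 0)).
  near=> y; rewrite IH//; near: y; exact: open_nbhs_nbhs.
by have [_ <-] := jet_derive j k x; have [_ ->] := h.
Unshelve. all: by end_near. Qed.

(** The jumps of the floor occur at integers, that is at the ends of the unit interval, near which
    [g] vanishes with all its derivatives; so the periodized pieces fit together smoothly. *)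
Lemma periodic_jet (g : jet R) (r : R) : 0 < r < 1 / 2 ->
  (forall x, r <= `|x - 1 / 2| -> g 0 x = 0) ->
  exists f : jet R, forall k x, f k x = g k (x - (Num.floor x)%:~R).
Proof.
move=> /andP[r0 r1] g0.
have gk k x : r < `|x - 1 / 2| -> g k x = 0.
  have oU : open [set x : R | r < `|x - 1 / 2|].
    have cU : continuous (fun x : R => `|x - 1 / 2|).
      move=> y; apply: cvg_norm; apply: cvgB; first exact: cvg_id.
      exact: cvg_cst.
    move/continuousP : cU => /(_ [set y : R | r < y]) h.
    exact: (h (@open_gt _ r)).
  by apply: (jet_zero_open oU) => y /ltW; exact: g0.
have h k x : is_derive x (1 : R)
    ((fun k x => g k (x - (Num.floor x)%:~R)) k)
    ((fun k x => g k (x - (Num.floor x)%:~R)) k.+1 x).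
  rewrite /=; set z := Num.floor x.
  have /andP[zx xz] := floor_itv x; rewrite -/z in zx xz.
  move: zx; rewrite le_eqVlt => /predU1P[zx|zx].
    rewrite -zx subrr gk; last by rewrite sub0r normrN ger0_norm//; lra.
    apply: (@near_eq_is_derive _ _ _ (cst 0)).
    have e0 : 0 < 1 / 2 - r by lra.
    near=> y; rewrite gk//.
    have : `|z%:~R - y| < 1 / 2 - r.
      near: y; apply/nbhs_ballP; exists (1 / 2 - r) => //= y.
    rewrite ltr_distl => /andP[y1 y2].
    have [yz|yz] := leP z%:~R y.
      rewrite (@floor_def _ y z); last by rewrite yz rmorphD/=; lra.
      by rewrite ltr_normr; apply/orP; right; lra.
    rewrite (@floor_def _ y (z - 1)); last by rewrite subrK yz rmorphB/=; lra.
    by rewrite rmorphB/= ltr_normr; apply/orP; left; lra.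
  have hx := @is_derive_affine R (g k) 1 (- z%:~R) x (g k.+1 (x - z%:~R)).
  rewrite !mul1r in hx.
  apply: near_eq_is_derive (hx (jet_derive _ _ _)); near=> y.
  rewrite mul1r (@floor_def _ y z)//; apply/andP; split.
    by apply/ltW; near: y; exact: lt_nbhsr.
  by near: y; exact: lt_nbhsl.
by exists (Jet h).
Unshelve. all: by end_near. Qed.

End Bumps.

(** * The two-valued periodic profile *)

Section Profile.
Variable R : realType.

Lemma periodic_int (f : R -> R) : (forall x, f (x + 1) = f x) ->
  forall x (z : int), f (x + z%:~R) = f x.
Proof.
move=> f1; have fn n x : f (x + n%:R) = f x.
  by elim: n x => [|n IH] x; rewrite ?addr0// -natr1 addrA f1.
move=> x [n|n]; first exact: fn.
by rewrite NegzE rmorphN/= -(fn n.+1) subrK.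
Qed.

Lemma periodic_bounded (f : R -> R) : continuous f -> (forall x, f (x + 1) = f x) ->
  exists C, forall x, `|f x| <= C.
Proof.
move=> cf f1; have cnf : {within `[0, 1], continuous (fun x => `|f x|)}.
  by apply: continuous_subspaceT => x; apply: cvg_norm; exact: cf.
have [c _ hc] := EVT_max (ler01 : 0 <= 1 :> R) cnf.
exists `|f c| => x; rewrite -(subrK (Num.floor x)%:~R x) periodic_int//.
by apply: hc; have := floor_itv x; rewrite in_itv/= rmorphD/=; lra.
Qed.

(** A primitive of a periodic function grows by a constant [c] over each period, and subtracting
    [c x] makes it periodic. Here [c] is the mean of [f]; the last clause computes it from any
    primitive of a function that agrees with [f] inside one period. *)
Lemma periodic_primitive (f : jet R) : (forall x, f 0 (x + 1) = f 0 x) ->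
  exists (p : jet R) (c : R), [/\ forall x, p 0 (x + 1) = p 0 x,
    forall x, p 1 x = f 0 x - c, forall x, p 2 x = f 1 x &
    forall Q q : R -> R, (forall x : R, is_derive x (1 : R) Q (q x)) ->
      (forall x, 0 < x < 1 -> q x = f 0 x) -> c = Q 1 - Q 0].
Proof.
move=> f1; have [P hP] := jet_prim f.
have dP x : is_derive x (1 : R) (P 0) (f 0 x) by rewrite -hP; exact: jet_derive.
have dP1 x : is_derive x (1 : R) (fun y => P 0 (y + 1)) (f 0 x).
  have := @is_derive_affine R (P 0) 1 1 x (f 0 (x + 1)).
  rewrite !mul1r => /(_ (dP _)); rewrite f1.
  by under eq_fun do rewrite mul1r.
have PD x : P 0 (x + 1) - P 0 x = P 0 1 - P 0 0.
  rewrite -[in X in _ = X - _](add0r 1).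
  apply: (@is_derive_0_is_cst R (fun x => P 0 (x + 1) - P 0 x)) => y.
  by have := is_deriveB (dP1 y) (dP y); rewrite subrr.
have [L [L0 L1 L2]] := jet_line (- (P 0 1 - P 0 0)) 0.
have [p hp] := jet_add P L.
exists p, (P 0 1 - P 0 0); split=> [x|x|x|Q q dQ qf].
- by rewrite !hp !L0; have := PD x; lra.
- by rewrite hp L1 hP.
- by rewrite hp L2 hP addr0.
- have dQP x : is_derive x (1 : R) (fun y => Q y - P 0 y) (q x - f 0 x).
    exact: is_deriveB (dQ x) (dP x).
  have [c /qf qc] := mean_value ltr01 dQP.
  by rewrite qc subrr mul0r; lra.
Qed.

(** [H 2] is [f - l] for a periodized plateau [f] of mean [l]. Integrating twice, with the mean
    removed each time, keeps [H 1] and [H 0] periodic, hence bounded. *)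
Lemma profile_exists (l e : R) : 0 < l < 1 -> 0 < e <= 1 ->
  exists (H : jet R) (C s1 L1 s2 L2 : R),
  [/\ forall k x, (k <= 2)%N -> `|H k x| <= C,
      forall x, - l <= H 2 x <= 1 - l,
      [/\ 0 <= L1 <= 1, 0 <= L2 <= 1, (1 - e) * l <= L1 & (1 - e) * (1 - l) <= L2],
      forall x (z : int), 0 < x - s1 - z%:~R < L1 -> H 2 x = 1 - l &
      forall x (z : int), 0 < x - s2 - z%:~R < L2 -> H 2 x = - l].
Proof.
(* The transition width is taken relative to [1 - l]: this keeps the half-width [r] of the bump
   below [1 / 2] even for [l] near 1, and the loss [2 * t] is exactly [e * (1 - l)]. *)
move=> /andP[l0 l1] /andP[e0 e1]; pose t := e * (1 - l) / 2.
have t0 : 0 < t by rewrite /t !mulr_gt0 ?invr_gt0// subr_gt0.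
have te : t <= e by rewrite /t; nra.
have t2 : 2 * t = e * (1 - l) by rewrite /t; lra.
have tl : t < 1 - l by nra.
have [|b [b01 b1 b0]] := @plateau_exists R t; first by lra.
have [B hB] := jet_prim b.
have dB x : is_derive x (1 : R) (B 0) (b 0 x) by rewrite -hB; exact: jet_derive.
pose I := B 0 1 - B 0 (-1).
have ndB x y : x <= y -> B 0 x <= B 0 y.
  rewrite le_eqVlt => /predU1P[->//|xy]; have [c _ h] := mean_value xy dB.
  rewrite -subr_ge0 h mulr_ge0//; first by case/andP: (b01 c).
  by rewrite subr_ge0 ltW.
have I2 : I <= 2.
  have [|c _] := @mean_value R (B 0) (b 0) (-1) 1 _ dB; first lra.
  by rewrite -/I => ->; have := b01 c; lra.
have It : 2 * (1 - t) <= I.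
  have [|c] := @mean_value R (B 0) (b 0) (- (1 - t)) (1 - t) _ dB; first lra.
  move=> hc; rewrite b1 ?ler_norml; last by lra.
  have := ndB (1 - t) 1; have := ndB (-1) (- (1 - t)); rewrite /I; lra.
(* Compressing the plateau, of integral [I], by the factor [r] gives mean exactly [l]; the bounds on
   [I] confine [2 * r] between [l] and [l / (1 - t)]. *)
pose r := l / I.
have I0 : 0 < I by lra.
have r0 : 0 < r by rewrite divr_gt0.
have rI : r * I = l by rewrite divfK// gt_eqF.
have r1 : r < 1 / 2 by rewrite ltr_pdivrMr//; lra.
have [g hg] := jet_comp_affine b 1 r^-1 (- (1 / 2) / r).
have gE x : g 0 x = b 0 ((x - 1 / 2) / r).
  by rewrite hg expr0 !mul1r; congr (b 0 _); ring.
have g0 x : r <= `|x - 1 / 2| -> g 0 x = 0.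
  move=> rx; rewrite gE b0// normrM [`|r^-1|]gtr0_norm ?invr_gt0//.
  by rewrite ler_pdivlMr//; lra.
have [|f hf] := @periodic_jet R g r _ g0; first by rewrite r0.
have f1 x : f 0 (x + 1) = f 0 x.
  rewrite !hf; have -> : Num.floor (x + 1) = Num.floor x + 1.
    by apply: floor_def; have := floor_itv x; rewrite !rmorphD/=; lra.
  by rewrite rmorphD/=; congr (g 0 _); ring.
have [p [c [p0 p1 p2 pc]]] := periodic_primitive f1.
have cl : c = l.
  pose Q x := r * B 0 (r^-1 * x + - (1 / 2) / r).
  have dQ x : is_derive x (1 : R) Q (g 0 x).
    have hZ := is_deriveZ r (is_derive_affine (dB (r^-1 * x + - (1 / 2) / r))).
    by apply: (is_derive_eq hZ); rewrite hg expr0 /GRing.scale/= mulrA divff ?gt_eqF// !mulr1.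
  rewrite (pc Q _ dQ) => [|x /andP[x0 x1]]; last first.
    by rewrite hf (@floor_def _ x 0) ?subr0// ltW.
  rewrite /Q -mulrBr -[RHS]rI; congr (r * _); rewrite /I.
  have BE u v : (forall w, u < w < v -> b 0 w = 0) -> u <= v -> B 0 v = B 0 u.
    move=> bw; rewrite le_eqVlt => /predU1P[->//|uv].
    have [w /bw w0 hw] := mean_value uv dB.
    by apply/eqP; rewrite -subr_eq0 hw w0 mul0r.
  have r2 : 1 <= (1 / 2) / r by rewrite ler_pdivlMr//; lra.
  congr (_ - _).
    apply: BE => [w /andP[w1 _]|]; last by have := r2; rewrite mulr1; lra.
    by apply: b0; rewrite ler_normr ltW.
  apply/esym; apply: BE => [w /andP[_ w1]|]; last by have := r2; rewrite mulr0; lra.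
  by apply: b0; rewrite ler_normr; apply/orP; right; lra.
have [H [d [H0 H1 H2 _]]] := periodic_primitive p0.
have HE x : H 2 x = f 0 x - l by rewrite H2 p1 cl.
have fE x : f 0 x = g 0 (x - (Num.floor x)%:~R) by exact: hf.
have [C0 hC0] := periodic_bounded (@jet_continuous R H 0) H0.
have [|C1 hC1] := periodic_bounded (@jet_continuous R H 1).
  by move=> x; rewrite !H1 p0.
exists H, (Num.max C0 (Num.max C1 1)), (1 / 2 - (1 - t) * r), (2 * (1 - t) * r),
  (1 / 2 + r), (1 - 2 * r).
have Hl x : - l <= H 2 x <= 1 - l.
  by rewrite HE fE gE; have := b01 ((x - (Num.floor x)%:~R - 1 / 2) / r); lra.
split=> //.
- case=> [|[|[|//]]] x _; rewrite !le_max ?hC0 ?hC1 ?orbT//.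
  by apply/orP; right; apply/orP; right; have := Hl x; rewrite ler_norml; lra.
- have r2 : l <= 2 * r by rewrite -rI mulrC ler_wpM2r// ltW.
  have rt : 2 * r * (1 - t) <= l.
    by rewrite -[leRHS]rI; nra.
  have h1 : (1 - e) * l <= 2 * (1 - t) * r.
    apply: (@le_trans _ _ ((1 - t) * l)); first by apply: ler_wpM2r; [exact: ltW|lra].
    have t1 : 0 < 1 - t by lra.
    by nra.
  have h2 : (1 - e) * (1 - l) <= 1 - 2 * r.
    have t1 : 0 < 1 - t by lra.
    have : 2 * r <= l + 2 * t by rewrite -(ler_pM2r t1) (le_trans rt)//; nra.
    by rewrite t2; lra.
  by split=> //; apply/andP; split; nra.
- move=> x z /andP[x1 x2].
  have xr : `|x - z%:~R - 1 / 2| <= (1 - t) * r by rewrite ler_norml; lra.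
  have fx : Num.floor x = z.
    apply: floor_def; rewrite rmorphD/=; have : (1 - t) * r < 1 / 2 by nra.
    by move: xr; rewrite ler_norml; lra.
  rewrite HE fE fx gE b1 // normrM [`|r^-1|]gtr0_norm ?invr_gt0//.
  by rewrite ler_pdivrMr.
- move=> x z /andP[x1 x2]; rewrite HE fE g0 ?sub0r//.
  (* The interval where [f] vanishes runs from [1 / 2 + r] to [3 / 2 - r] and crosses an integer, so
     the floor takes two values on it. *)
  have [xz|xz] := ltP (x - z%:~R) 1.
    rewrite (@floor_def _ x z); last by rewrite rmorphD/=; lra.
    by rewrite ler_normr; apply/orP; left; lra.
  rewrite (@floor_def _ x (z + 1)); last by rewrite !rmorphD/=; lra.
  by rewrite rmorphD/= ler_normr; apply/orP; right; lra.
Qed.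

End Profile.

(** * Ridge expressions *)

Section Expressions.
Variables (R : realType) (d : nat).
Local Notation V := 'rV[R]_d.
Implicit Types (u v w x : V).

Definition dot w x : R := \sum_i w 0 i * x 0 i.

Lemma dotD w x y : dot w (x + y) = dot w x + dot w y.
Proof. by rewrite /dot -big_split; apply: eq_bigr => i _; rewrite mxE mulrDr. Qed.

Lemma dotZ w (a : R) x : dot w (a *: x) = a * dot w x.
Proof. by rewrite /dot mulr_sumr; apply: eq_bigr => i _; rewrite mxE mulrCA. Qed.

Lemma dot_unitv w k : dot w (unitv R k) = w 0 k.
Proof.
rewrite /dot (bigD1 k)//= big1 ?addr0 => [|i ik]; rewrite mxE eqxx/=.
  by rewrite eqxx mulr1.
by rewrite (negbTE ik) mulr0.
Qed.

Lemma dot_continuous w : continuous (dot w).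
Proof.
apply: continuous_big => [|i _ x]; first exact: add_continuous.
exact: cvgMl_tmp (@coord_continuous _ _ _ _ _ _).
Qed.

(* Smooth functions built from ridge functions [x |-> h^(k)(w.x + b)]; since
   differentiation acts on the syntax, partial derivatives of all orders exist
   and commute without an appeal to Schwarz's theorem. *)
Inductive expr :=
| Cst of R
| Ridge of jet R & nat & V & R
| Add of expr & expr
| Mul of expr & expr.

Fixpoint ev (e : expr) (x : V) : R := match e with
  | Cst c => c
  | Ridge j k w b => j k (dot w x + b)
  | Add e1 e2 => ev e1 x + ev e2 x
  | Mul e1 e2 => ev e1 x * ev e2 x
  end.

Fixpoint dE (v : V) (e : expr) : expr := match e with
  | Cst _ => Cst 0
  | Ridge j k w b => Mul (Cst (dot w v)) (Ridge j k.+1 w b)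
  | Add e1 e2 => Add (dE v e1) (dE v e2)
  | Mul e1 e2 => Add (Mul (dE v e1) e2) (Mul e1 (dE v e2))
  end.

Lemma ev_continuous e : continuous (ev e).
Proof.
elim: e => [c|j k w b|e1 IH1 e2 IH2|e1 IH1 e2 IH2] x.
- exact: (@cst_continuous _ _ c x).
- apply: (@continuous_comp _ _ _ (fun y => dot w y + b) (j k)).
    exact: cvgD (@dot_continuous w x) (@cst_continuous _ _ b x).
  exact: jet_continuous.
- exact: cvgD (IH1 x) (IH2 x).
- exact: cvgM (IH1 x) (IH2 x).
Qed.

Lemma is_derive_dir (f : R -> R) (y m df : R) : is_derive y (1 : R) f df ->
  is_derive y m f (m * df).
Proof.
move=> [/derivable1_diffP dfy <-]; apply: DeriveDef.
  exact: diff_derivable.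
by rewrite !deriveE// -[m in LHS]mulr1 -[m * 1]/(m *: (1 : R)) linearZ.
Qed.

Lemma is_derive_ev e x v : is_derive x v (ev e) (ev (dE v e) x).
Proof.
elim: e => [c|j k w b|e1 IH1 e2 IH2|e1 IH1 e2 IH2] /=.
- exact: is_derive_cst.
- have [h1 h2] := is_derive_dir (dot w v) (jet_derive j k (dot w x + b)).
  have E : (fun h : R => h^-1 *: (j k (dot w (h *: v + x) + b) - j k (dot w x + b)))
      = (fun h : R => h^-1 *: (j k (h *: dot w v + (dot w x + b)) - j k (dot w x + b))).
    by apply/funext => h; rewrite dotD dotZ addrA.
  apply: DeriveDef; first by rewrite /derivable/= E; exact: h1.
  by rewrite /derive/= E; exact: h2.
- exact: is_deriveD IH1 IH2.
- have hM := is_deriveM IH1 IH2.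
  by apply: (is_derive_eq hM); rewrite /GRing.scale/=; ring.
Qed.

Lemma ev_dEC e u v x : ev (dE u (dE v e)) x = ev (dE v (dE u e)) x.
Proof.
elim: e => [c|j k w b|e1 IH1 e2 IH2|e1 IH1 e2 IH2] //=; first ring.
  by rewrite IH1 IH2.
by rewrite IH1 IH2; ring.
Qed.

Lemma ev_dED e u v x : ev (dE (u + v) e) x = ev (dE u e) x + ev (dE v e) x.
Proof.
elim: e => [c|j k w b|e1 IH1 e2 IH2|e1 IH1 e2 IH2] /=.
- by rewrite addr0.
- by rewrite dotD mulrDl.
- by rewrite IH1 IH2; ring.
- by rewrite IH1 IH2; ring.
Qed.

Lemma ev_dEZ e (a : R) v x : ev (dE (a *: v) e) x = a * ev (dE v e) x.
Proof.
elim: e => [c|j k w b|e1 IH1 e2 IH2|e1 IH1 e2 IH2] /=.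
- by rewrite mulr0.
- by rewrite dotZ mulrA.
- by rewrite IH1 IH2; ring.
- by rewrite IH1 IH2; ring.
Qed.

Lemma ev_dE_sum e (I : finType) (F : I -> V) x :
  ev (dE (\sum_i F i) e) x = \sum_i ev (dE (F i) e) x.
Proof.
apply: (big_morph (fun v => ev (dE v e) x)) => [u v|]; first exact: ev_dED.
by rewrite -(scale0r 0) ev_dEZ mul0r.
Qed.

Lemma ev_dE_open e v (U : set V) : open U -> (forall x, U x -> ev e x = 0) ->
  forall x, U x -> ev (dE v e) x = 0.
Proof.
move=> oU U0 x Ux; have [_ <-] := is_derive_ev e x v.
rewrite (@near_eq_derive _ _ _ (ev e) (cst 0)) ?derive_cst//.
near=> y; rewrite U0//; near: y; exact: open_nbhs_nbhs.
Unshelve. all: by end_near. Qed.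

Definition mev m n (E : 'I_m -> 'I_n -> expr) (x : V) : 'M[R]_(m, n) :=
  \matrix_(i, j) ev (E i j) x.

Lemma is_derive_mev m n (E : 'I_m -> 'I_n -> expr) x v :
  is_derive x v (mev E) (mev (fun i j => dE v (E i j)) x).
Proof.
have dvE i j : (fun y => mev E y i j) = ev (E i j).
  by apply/funext => y; rewrite mxE.
have dv : derivable (mev E) x v.
  by apply/derivable_mxP => i j; rewrite dvE; case: (is_derive_ev (E i j) x v).
apply: DeriveDef => //; rewrite derive_mx//; apply/matrixP => i j; rewrite !mxE dvE.
by have [_ ->] := is_derive_ev (E i j) x v.
Qed.

Lemma partial_mev m n (E : 'I_m -> 'I_n -> expr) k :
  partial k (mev E) = mev (fun i j => dE (unitv R k) (E i j)).
Proof.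
by apply/funext => x; rewrite /partial; have [_ ->] := is_derive_mev E x (unitv R k).
Qed.

Lemma mev_continuous m n (E : 'I_m -> 'I_n -> expr) : continuous (mev E).
Proof.
move=> x; apply/(@cvgrPdist_lt _ _ _ (nbhs x) (nbhs_filter x)) => e e0; near=> y.
rewrite [ltLHS]/Num.norm/= mx_normrE; apply/bigmax_ltP; split => // -[i j] _ /=.
rewrite !mxE; move: i j; near: y.
apply: filter_forall => i; apply: filter_forall => j.
exact: ((cvgrPdist_lt _ _).1 (@ev_continuous (E i j) x) e e0).
Unshelve. all: by end_near. Qed.

Lemma smooth_mev m n (E : 'I_m -> 'I_n -> expr) : smooth (mev E).
Proof.
move=> s; have [E' ->] : exists E', iter_partial s (mev E) = mev E'.
  elim: s => [|k s [E' IH]]; first by exists E.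
  by rewrite /= IH partial_mev; eexists.
split=> [|k p]; first exact: mev_continuous.
by have [] := is_derive_mev E' p (unitv R k).
Qed.

End Expressions.

(** * Cutoff functions *)

Lemma mx_norm_le (R : realType) m n (A : 'M[R]_(m, n)) (e : R) : 0 <= e ->
  (forall i j, `|A i j| <= e) -> `|A| <= e.
Proof.
move=> e0 h; rewrite /Num.norm/= mx_normrE; by apply: bigmax_le => // -[i j] _.
Qed.

Lemma le_mx_norm (R : realType) m n (A : 'M[R]_(m, n)) i j : `|A i j| <= `|A|.
Proof.
rewrite [leRHS]/Num.norm/= mx_normrE.
exact: (le_bigmax _ (fun ij => `|A ij.1 ij.2|) (i, j)).
Qed.

Section Cutoff.
Variables (R : realType) (d : nat).
Local Notation V := 'rV[R]_d.+1.
Implicit Types (x y c : V) (G K U : set V).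

(** The norm is the maximum norm: balls are cubes, and a product of one-variable plateaus in the
    coordinates is a cutoff for them. *)
Lemma ball_bump_exists c (r : R) : 0 < r -> exists Z : expr R d.+1,
  [/\ forall x, 0 <= ev Z x <= 1, forall x, r < `|x - c| -> ev Z x = 0 &
      forall x, ball c (r / 2) x -> ev Z x = 1].
Proof.
move=> r0; have [|b [b01 b1 b0]] := @plateau_exists R (1 / 2); first lra.
pose F j := Ridge b 0 (r^-1 *: unitv R j : V) (- (c 0 j / r)).
have FE j x : ev (F j) x = b 0 ((x 0 j - c 0 j) / r).
  rewrite /= /dot (bigD1 j)//= big1 ?addr0 => [|i ij]; rewrite !mxE eqxx/=.
    by rewrite eqxx mulr1 mulrBl mulrC.
  by rewrite (negbTE ij) mulr0 mul0r.
pose Z s := foldr (fun j E => Mul (F j) E) (Cst d.+1 1) s.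
have ZE s x : ev (Z s) x = \prod_(j <- s) b 0 ((x 0 j - c 0 j) / r).
  elim: s => [|j s IH]; first by rewrite big_nil.
  by rewrite big_cons -IH -FE.
exists (Z (enum 'I_d.+1)); split=> x; rewrite ZE.
- elim: (enum _) => [|j s /andP[s0 s1]]; first by rewrite big_nil ler01 lexx.
  have /andP[h0 h1] := b01 ((x 0 j - c 0 j) / r).
  by rewrite big_cons mulr_ge0// mulr_ile1.
- move=> rx; have [[i j] /= hj] : exists ij, `|x - c| = `|(x - c) ij.1 ij.2|.
    by apply: mx_norm_neq0; rewrite gt_eqF// (lt_trans r0).
  rewrite big_enum (bigD1 j)//= b0 ?mul0r//.
  rewrite normrM [`|r^-1|]gtr0_norm ?invr_gt0// ler_pdivlMr// mul1r.
  by move: rx; rewrite hj ord1 !mxE => /ltW.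
- move=> [_ hx]; rewrite big1_seq// => j _; rewrite b1//.
  rewrite normrM [`|r^-1|]gtr0_norm ?invr_gt0// ler_pdivrMr//.
  by have := hx 0 j; rewrite /ball/= distrC => /ltW; lra.
Qed.

Lemma closed_norm_ball c (r : R) : 0 < r -> closed [set x | `|x - c| <= r].
Proof.
move=> r0; rewrite (_ : mkset _ = closed_ball c r); first exact: closed_ball_closed.
by rewrite closed_ballE//; apply/seteqP; split => x; rewrite /closed_ball_/= distrC.
Qed.

(** Cutoffs are glued by [1 - (1 - Z) * (1 - B)], which stays between 0 and 1, is 1 where one of the
    two is 1, and vanishes where both vanish. *)
Lemma cutoff_balls G (s : seq (V * R)) : bounded_set G ->
  (forall z, z \in s -> 0 < z.2 /\ [set x | `|x - z.1| <= z.2] `<=` G) ->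
  exists (Z : expr R d.+1) K U (rho : R),
  [/\ compact K, K `<=` G, forall x, 0 <= ev Z x <= 1, forall x, ~ K x -> ev Z x = 0 &
    [/\ open U, U `<=` K, forall x, U x -> ev Z x = 1, 0 < rho &
        forall x y, (exists2 z, z \in s & ball z.1 (z.2 / 4) x) -> `|y| <= rho ->
          U (x + y)]].
Proof.
move=> bG; elim: s => [|[c r] s IH] hs.
  exists (Cst _ 0), set0, set0, 1; split => //.
  - exact: compact0.
  - by move=> x /=; rewrite lexx ler01.
  - by split => //; move=> x y [].
have [z zs|Z [K [U [rho [cK KG Z01 ZK [oU UK ZU rho0 hU]]]]]] := IH.
  by apply: hs; rewrite inE zs orbT.
have [/= r0 cG] := hs _ (mem_head _ _).
have [B [B01 B0 B1]] := ball_bump_exists c r0.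
exists (Add (Cst _ 1) (Mul (Cst _ (-1))
    (Mul (Add (Cst _ 1) (Mul (Cst _ (-1)) Z)) (Add (Cst _ 1) (Mul (Cst _ (-1)) B))))),
  (K `|` [set x | `|x - c| <= r]), (U `|` ball c (r / 2)), (Num.min rho (r / 4)).
split.
- apply: compactU => //; apply: bounded_closed_compact; last exact: closed_norm_ball.
  exact: sub_bounded_set cG bG.
- by move=> x [/KG|/cG].
- move=> x /=; have := Z01 x; have := B01 x; move: (ev Z x) (ev B x) => p q; nra.
- move=> x /not_orP[/ZK hZ hc] /=; rewrite hZ B0 ?subr0; first ring.
  by rewrite ltNge; apply/negP.
- split.
  + by apply: openU => //; apply: ball_open; rewrite divr_gt0.
  + move=> x [/UK|]; [by left|rewrite mx_norm_ball /ball_/= => h; right => /=].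
    by rewrite distrC; lra.
  + by move=> x [/ZU hx|/B1 hx] /=; rewrite hx; ring.
  + by rewrite lt_min rho0 divr_gt0.
  + move=> x y [z]; rewrite inE => /predU1P[-> /=|zs zx]; last first.
      by rewrite le_min => /andP[yr _]; left; apply: hU => //; exists z.
    rewrite le_min !mx_norm_ball /ball_/= => xc /andP[_ yr]; right.
    rewrite /ball_/= opprD addrA (le_lt_trans (ler_normB _ _))//.
    lra.
Qed.

(** [U] is where the cutoff is 1, [U'] is what carries the volume; the margin [rho] between them
    absorbs the translations in [vol_strips]. *)
Lemma cutoff_exists G (e : R) : open G -> bounded_set G -> 0 < e ->
  exists (Z : expr R d.+1) K U U' (rho : R),
  [/\ compact K, K `<=` G, forall x, 0 <= ev Z x <= 1, forall x, ~ K x -> ev Z x = 0 &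
    [/\ open U, U `<=` K, forall x, U x -> ev Z x = 1 &
     [/\ 0 < rho, open U', forall x y, U' x -> `|y| <= rho -> U (x + y) &
        (1 - e) * vol G <= vol U']]].
Proof.
move=> oG bG e0; have [s [hs vs]] := inner_balls oG bG e0.
have [Z [K [U [rho [cK KG Z01 ZK [oU UK ZU rho0 hU]]]]]] := cutoff_balls bG hs.
have oU' : open [set x | exists2 z, z \in s & ball z.1 (z.2 / 4) x].
  rewrite (_ : mkset _ = \bigcup_(z in [set` s]) ball z.1 (z.2 / 4)).
    by apply: bigcup_open => z /= zs; apply: ball_open.
  by apply/seteqP; split => x [z zs zx]; exists z.
by exists Z, K, U, [set x | exists2 z, z \in s & ball z.1 (z.2 / 4) x], rho.
Qed.

Lemma bounded_off_compact (f : V -> R) K : compact K -> continuous f ->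
  (forall x, ~ K x -> f x = 0) -> exists C, forall x, `|f x| <= C.
Proof.
move=> cK cf f0.
have /compact_bounded[M [_ hM]] := continuous_compact (continuous_subspaceT cf) cK.
exists (Num.max 0 (M + 1)) => x; rewrite le_max.
have [Kx|/f0 ->] := pselect (K x); last by rewrite normr0 lexx.
by apply/orP; right; apply: (hM (M + 1)); [rewrite ltrDl|exists x].
Qed.

End Cutoff.

(** * Localized plane waves *)

Section Oscillation.
Variables (R : realType) (n : nat).
Local Notation V := 'rV[R]_n.+1.
Implicit Types (x y w : V).

(** Order [e] in the wavelength, uniformly in the point. *)
Definition small_osc (F : R -> V -> R) :=
  exists M, forall e, 0 < e <= 1 -> forall x, `|F e x| <= e * M.

Lemma small_oscD F1 F2 : small_osc F1 -> small_osc F2 ->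
  small_osc (fun e x => F1 e x + F2 e x).
Proof.
move=> [M1 h1] [M2 h2]; exists (M1 + M2) => e he x.
by rewrite mulrDr (le_trans (ler_normD _ _))// lerD ?h1 ?h2.
Qed.

Lemma small_oscZ (a : R) F : small_osc F -> small_osc (fun e x => a * F e x).
Proof.
move=> [M h]; exists (`|a| * M) => e he x.
by rewrite normrM mulrCA ler_wpM2l ?h.
Qed.

Lemma small_osc_near F (nu : R) : small_osc F -> 0 < nu ->
  \forall e \near 0^'+, forall x, `|F e x| <= nu.
Proof.
move=> [M h] nu0.
have M0 : 0 < nu / (`|M| + 1) by rewrite divr_gt0// ltr_wpDl.
near=> e => x; have e0 : 0 < e by [].
have e1 : e <= 1 by near: e; exact: nbhs_right_le.
apply: (le_trans (h e _ x)); first by rewrite e0.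
have eM : e <= nu / (`|M| + 1) by near: e; exact: nbhs_right_le.
move: eM; rewrite ler_pdivlMr ?ltr_wpDl//; apply: le_trans.
apply: ler_wpM2l; first exact: ltW.
by apply: le_trans (ler_norm M) _; rewrite lerDl.
Unshelve. all: by end_near. Qed.

Lemma dotZl (a : R) w x : dot (a *: w) x = a * dot w x.
Proof. by rewrite /dot mulr_sumr; apply: eq_bigr => i _; rewrite mxE mulrA. Qed.

(** A purely spatial direction, with time component 0. *)
Definition emb (y : 'I_n -> R) : V := \sum_k y k *: unitv R (xcoord k).

Lemma ev_dE_emb (E : expr R n.+1) (y : 'I_n -> R) x :
  ev (dE (emb y) E) x = \sum_k y k * ev (dE (unitv R (xcoord k)) E) x.
Proof. by rewrite ev_dE_sum; apply: eq_bigr => k _; rewrite ev_dEZ. Qed.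

Lemma dot_emb w (y : 'I_n -> R) : dot w (emb y) = \sum_k y k * w 0 (xcoord k).
Proof.
rewrite (big_morph (dot w) (dotD w) (_ : dot w 0 = 0)).
  by apply: eq_bigr => k _; rewrite dotZ dot_unitv.
by rewrite -(scale0r 0) dotZ mul0r.
Qed.

Lemma wave_vector_exists (a : 'I_n -> R) (c : R) :
  exists w : V, (forall k, w 0 (xcoord k) = a k) /\ w 0 (tcoord n) = c.
Proof.
exists (\row_j (if unlift ord_max j is Some k then a k else c)); split=> [k|].
  rewrite mxE (_ : xcoord k = lift ord_max k) ?liftK//.
  by apply: val_inj; rewrite /= /bump leqNgt ltn_ord.
by rewrite mxE unlift_none.
Qed.

(** The factor [e ^+ 2] offsets two derivatives of the fast profile; [b] is a normalization of the
    amplitude. *)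
Definition osc (Z : expr R n.+1) (H : jet R) w (b e : R) : expr R n.+1 :=
  Mul (Cst _ (e ^+ 2 * b)) (Mul Z (Ridge H 0 (e^-1 *: w) 0)).

Variables (Z : expr R n.+1) (H : jet R) (w : V) (b C : R) (K : set V).
Hypotheses (cK : compact K) (Z01 : forall x, 0 <= ev Z x <= 1)
  (ZK : forall x, ~ K x -> ev Z x = 0)
  (HC : forall k (s : R), (k <= 2)%N -> `|H k s| <= C).

Let oK : open (~` K).
Proof. by apply: closed_openC; apply: compact_closed. Qed.

Let dZK y x : ~ K x -> ev (dE y Z) x = 0.
Proof. by move=> Kx; exact: (ev_dE_open _ oK ZK). Qed.

Let ddZK y y' x : ~ K x -> ev (dE y (dE y' Z)) x = 0.
Proof. by move=> Kx; apply: (ev_dE_open _ oK) => // z; exact: dZK. Qed.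

Let dZ_bounded y : exists D, forall x, `|ev (dE y Z) x| <= D.
Proof. exact: bounded_off_compact cK (@ev_continuous _ _ _) (@dZK y). Qed.

Let ddZ_bounded y y' : exists D, forall x, `|ev (dE y (dE y' Z)) x| <= D.
Proof. exact: bounded_off_compact cK (@ev_continuous _ _ _) (@ddZK y y'). Qed.

Let Z1 x : `|ev Z x| <= 1.
Proof. by have /andP[z0 z1] := Z01 x; rewrite ger0_norm. Qed.

Let nM (r s A B : R) : `|r| <= A -> `|s| <= B -> `|r * s| <= A * B.
Proof. by move=> h1 h2; rewrite normrM ler_pM. Qed.

Let nD (r s A B : R) : `|r| <= A -> `|s| <= B -> `|r + s| <= A + B.
Proof. by move=> h1 h2; rewrite (le_trans (ler_normD _ _))// lerD. Qed.

Lemma osc_off e x : ~ K x -> ev (osc Z H w b e) x = 0.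
Proof. by move=> /ZK /= ->; rewrite mul0r mulr0. Qed.

Lemma dosc_off e y x : ~ K x -> ev (dE y (osc Z H w b e)) x = 0.
Proof. by move=> Kx; apply: (ev_dE_open _ oK) => // z; exact: osc_off. Qed.

Lemma dosc_small y : small_osc (fun e => ev (dE y (osc Z H w b e))).
Proof.
have [D hD] := dZ_bounded y.
exists (`|b| * (1 * (D * C) + 1 * (`|dot w y| * C))) => e /andP[e0 e1] x.
have -> : ev (dE y (osc Z H w b e)) x = e * (b * (
   e * (ev (dE y Z) x * H 0 (dot (e^-1 *: w) x + 0)) +
   ev Z x * (dot w y * H 1 (dot (e^-1 *: w) x + 0)))).
  by rewrite /= !dotZl; field; rewrite gt_eqF.
have en : `|e| <= 1 by rewrite gtr0_norm.
rewrite normrM gtr0_norm//; apply: ler_wpM2l; first exact: ltW.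
apply: nM (lexx _) _.
apply: nD; first exact: nM en (nM (hD x) (HC _ _)).
exact: nM (Z1 x) (nM (lexx _) (HC _ _)).
Qed.

(** In the subtracted term both derivatives fall on the profile. In every other term at least one
    falls on the cutoff, so a factor [e] remains. *)
Lemma ddosc_small y y' : small_osc (fun e x => ev (dE y (dE y' (osc Z H w b e))) x -
  ev Z x * H 2 (dot (e^-1 *: w) x + 0) * (dot w y * dot w y' * b)).
Proof.
have [D hD] := dZ_bounded y; have [D' hD'] := dZ_bounded y'.
have [DD hDD] := ddZ_bounded y y'.
exists (`|b| * (1 * (DD * C) + (D' * `|dot w y| + D * `|dot w y'|) * C)) => e /andP[e0 e1] x.
rewrite (_ : _ - _ = e * (b * (
   e * (ev (dE y (dE y' Z)) x * H 0 (dot (e^-1 *: w) x + 0)) +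
   (ev (dE y' Z) x * dot w y + ev (dE y Z) x * dot w y') *
     H 1 (dot (e^-1 *: w) x + 0)))); last first.
  by rewrite /= !dotZl; field; rewrite gt_eqF.
have en : `|e| <= 1 by rewrite gtr0_norm.
rewrite normrM gtr0_norm//; apply: ler_wpM2l; first exact: ltW.
apply: nM (lexx _) _.
apply: nD; first exact: nM en (nM (hDD x) (HC _ _)).
apply: nM; last exact: HC.
exact: nD (nM (hD' x) (lexx _)) (nM (hD x) (lexx _)).
Qed.

(** On an open set where [Z] is 1 its derivatives vanish and the leading term is exact; the exactly
    attained values of the field come from here. *)
Lemma ddosc_plateau U e y y' x : 0 < e -> open U -> (forall x, U x -> ev Z x = 1) ->
  U x -> ev (dE y (dE y' (osc Z H w b e))) x =
    H 2 (dot (e^-1 *: w) x + 0) * (dot w y * dot w y' * b).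
Proof.
move=> e0 oU ZU Ux.
have dZ0 v z : U z -> ev (dE v Z) z = 0.
  have h0 t : U t -> ev (Add Z (Cst _ (-1))) t = 0 by move=> /ZU /= ->; rewrite subrr.
  by move=> Uz; have := ev_dE_open v oU h0 Uz; rewrite /= addr0.
have ddZ0 : ev (dE y (dE y' Z)) x = 0 by apply: (ev_dE_open _ oU) => // z; exact: dZ0.
rewrite /= ddZ0 !dZ0// ZU// !dotZl; field.
by rewrite gt_eqF.
Qed.

End Oscillation.

Lemma open_strips (R : realType) (d : nat) (s : 'rV[R]_d -> R) (L : R) : continuous s ->
  open [set x | exists z : int, 0 < s x - z%:~R < L].
Proof.
move=> cs; rewrite (_ : mkset _ =
    \bigcup_(z : int) (s @^-1` ([set y | z%:~R < y] `&` [set y | y < L + z%:~R]))).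
  apply: bigcup_open => z _; move/continuousP : cs; apply.
  by apply: openI; [exact: open_gt|exact: open_lt].
apply/seteqP; split => x /=.
  by move=> [z /andP[h1 h2]]; exists z => //=; split; lra.
by move=> [z _ /= [h1 h2]]; exists z; lra.
Qed.

(** * Perturbing a constant state by one plane wave *)

Section Splitting.
Variables (R : realType) (m n : nat).
Local Notation V := 'rV[R]_n.+1.
Local Notation M := ('M[R]_(m, n) * 'M[R]_(m, n))%type.
Local Notation coeff k := ('I_m -> 'I_k -> expr R n.+1).
Implicit Types (x : V) (G U : set V) (phi : coeff 1) (psi g : coeff n).

Lemma dt_mev k (E : coeff k) :
  dt (mev E) = mev (fun i j => dE (unitv R (tcoord n)) (E i j)).
Proof. exact: partial_mev. Qed.

Lemma mev_dE_off k (E : coeff k) v (K : set V) : compact K ->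
  (forall x, ~ K x -> mev E x = 0) ->
  forall x, ~ K x -> mev (fun i j => dE v (E i j)) x = 0.
Proof.
move=> cK E0 x Kx; apply/matrixP => i j; rewrite !mxE.
have oK : open (~` K) by apply: closed_openC; exact: compact_closed.
apply: (ev_dE_open _ oK) => // y /E0 /matrixP/(_ i j).
by rewrite !mxE.
Qed.

Lemma ev_scale (k : R) E x : ev (Mul (Cst n.+1 k) E) x = k * ev E x.
Proof. by []. Qed.

Lemma ev_add (E1 E2 : expr R n.+1) x : ev (Add E1 E2) x = ev E1 x + ev E2 x.
Proof. by []. Qed.

Lemma ev_dE_scale v (k : R) E x : ev (dE v (Mul (Cst n.+1 k) E)) x = k * ev (dE v E) x.
Proof. by rewrite /= mul0r add0r. Qed.

Lemma ev_dE_add v (E1 E2 : expr R n.+1) x :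
  ev (dE v (Add E1 E2)) x = ev (dE v E1) x + ev (dE v E2) x.
Proof. by []. Qed.

Definition gradient_field phi psi x : M := (Dx (mev phi) x, dt (mev psi) x).

Lemma gradient_fieldE phi psi x : gradient_field phi psi x =
  (\matrix_(r, k) ev (dE (unitv R (xcoord k)) (phi r 0)) x,
   mev (fun i j => dE (unitv R (tcoord n)) (psi i j)) x).
Proof.
rewrite /gradient_field dt_mev; congr (_, _).
by apply/matrixP => r k; rewrite !mxE partial_mev mxE.
Qed.

(** The identities and bounds hold on the whole space, so perturbations with nested supports can
    simply be added. *)
Definition perturbation G (e : R) phi psi g : Prop :=
  [/\ exists K, [/\ compact K, K `<=` G & forall x, ~ K x ->
        [/\ mev phi x = 0, mev psi x = 0 & mev g x = 0]],
      forall x, divx (mev psi) x = 0, forall x, divx (mev g) x = mev phi x &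
      forall x, [/\ `|mev phi x| <= e, `|dt (mev phi) x| <= e &
        `|dt (mev g) x| <= e]].

Lemma perturbation0 G (e : R) : 0 <= e ->
  perturbation G e (fun _ _ => Cst _ 0) (fun _ _ => Cst _ 0) (fun _ _ => Cst _ 0).
Proof.
move=> e0; have h k x : mev ((fun _ _ => Cst _ 0) : coeff k) x = 0.
  by apply/matrixP => i j; rewrite !mxE.
have dh k x v : mev ((fun _ _ => dE v (Cst _ 0)) : coeff k) x = 0.
  by apply/matrixP => i j; rewrite !mxE.
have div0 x : divx (mev ((fun _ _ => Cst _ 0) : coeff n)) x = 0.
  apply/matrixP => i j; rewrite !mxE big1// => k _.
  by rewrite partial_mev mxE.
split=> [|x|x|x]; rewrite ?h ?div0//.
  by exists set0; split=> //; exact: compact0.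
by rewrite !dt_mev !dh !normr0.
Qed.

Lemma gradient_field0 x :
  gradient_field (fun _ _ => Cst _ 0) (fun _ _ => Cst _ 0) x = 0.
Proof. by rewrite gradient_fieldE; congr (_, _); apply/matrixP => i j; rewrite !mxE. Qed.

(* The oscillation runs in the space-time direction [(a, c)]: a small time
   component [c] makes [D phi] and [dt psi] oscillate together with amplitude
   of order one while [dt phi] is of order [c]. *)
Lemma wave_exists (p : 'cV[R]_m) (a : 'cV[R]_n) (B : 'M[R]_(m, n)) (l e : R) G :
  a != 0 -> B *m a = 0 -> 0 < l < 1 -> 0 < e <= 1 -> open G -> bounded_set G ->
  exists phi psi g (G1 G2 : set V),
  [/\ perturbation G e phi psi g,
    forall x, exists2 q, - l <= q <= 1 - l &
      dist2 (gradient_field phi psi x) (q *: (p *m a^T, B)) < e,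
    [/\ open G1, open G2, G1 `&` G2 = set0 & exists K,
      [/\ compact K, K `<=` G, G1 `<=` K & G2 `<=` K]],
    (forall x, G1 x -> gradient_field phi psi x = (1 - l) *: (p *m a^T, B)) /\
    (forall x, G2 x -> gradient_field phi psi x = (- l) *: (p *m a^T, B)) &
    (1 - e) * l * vol G <= vol G1 /\ (1 - e) * (1 - l) * vol G <= vol G2].
Proof.
move=> a0 Ba /andP[l0 l1] /andP[e0 e1] oG bG.
(* The cutoff and the profile each lose a share [e / 2] of the volume. *)
have e20 : 0 < e / 2 by rewrite divr_gt0.
have [Z [K [U [U' [rho [cK KG Z01 ZK [oU UK ZU [rho0 oU' hU vU']]]]]]]] :=
  cutoff_exists oG bG e20.
have [||H [C [s1 [L1 [s2 [L2 [HC Hl [L1b L2b hL1 hL2] H1 H2]]]]]]] :=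
  @profile_exists R l (e / 2); [by rewrite l0|by lra|].
(* The squared Euclidean length of [a], which is the derivative of the phase along [A]; the
   amplitude is divided by it. *)
pose alpha := \sum_k a k 0 * a k 0.
have alpha0 : 0 < alpha.
  have [k ak] : exists k, a k 0 != 0.
    apply: contrapT => /forallNP h; move/eqP: a0; apply; apply/matrixP => k j.
    by rewrite ord1 mxE; have := h k; case: eqP.
  rewrite /alpha (bigD1 k)//= ltr_wpDr//.
    by apply: sumr_ge0 => j _; rewrite -expr2 sqr_ge0.
  by rewrite -expr2 lt_def sqr_ge0 sqrf_eq0 ak.
(* The leading part of [dt phi] is [c] times [p], up to a factor of modulus at most 1. Since [c] is
   fixed before the wavelength, the divisions by [c] below only change the constants in the error
   terms. *)
pose c := e / (4 * (`|p| + 1)).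
have p1 : 0 < `|p| + 1 by rewrite ltr_wpDl.
have c0 : 0 < c by rewrite divr_gt0// mulr_gt0.
have pc r : `|p r 0| * c <= e / 4.
  have -> : e / 4 = (`|p| + 1) * c by rewrite /c; field; rewrite gt_eqF.
  apply: ler_wpM2r; first exact: ltW.
  by apply: le_trans (le_mx_norm p r 0) _; rewrite lerDl.
have [w [wa wc]] := wave_vector_exists (fun k => a k 0) c.
pose A : V := emb (fun k => a k 0); pose Bd r : V := emb (fun k => B r k).
pose T : V := unitv R (tcoord n); pose X k : V := unitv R (@xcoord n k).
have wA : dot w A = alpha by rewrite dot_emb /alpha; apply: eq_bigr => k _; rewrite wa.
(* [B *m a = 0] makes the phase constant along the rows of [B], so the second term of [psi]
   contributes only errors to [dt psi]. *)
have wB r : dot w (Bd r) = 0.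
  have : (B *m a) r 0 = 0 by rewrite Ba mxE.
  rewrite mxE dot_emb => h; rewrite -[RHS]h.
  by apply: eq_bigr => k _; rewrite wa.
have wT : dot w T = c by rewrite dot_unitv wc.
have wX k : dot w (X k) = a k 0 by rewrite dot_unitv wa.
pose u eps := osc Z H w alpha^-1 eps.
pose h2 eps x := H 2 (dot (eps^-1 *: w) x + 0).
have small1 y := dosc_small w alpha^-1 cK Z01 ZK HC y.
have small2 y y' := ddosc_small w alpha^-1 cK ZK HC y y'.
(* [Q0] to [Q4] are the entries of [phi], [dt phi], [dt g], [D phi] and [dt psi], less their leading
   terms where these are not small with [eps]. *)
pose Q0 r eps x := p r 0 * ev (dE A (u eps)) x.
pose Q1 r eps x := p r 0 * ev (dE T (dE A (u eps))) x - p r 0 * (ev Z x * h2 eps x * c).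
pose Q2 r k eps x := p r 0 * a k 0 * ev (dE T (u eps)) x.
pose Q3 r k eps x := p r 0 * ev (dE (X k) (dE A (u eps))) x -
  ev Z x * h2 eps x * (p r 0 * a k 0).
pose Q4 r k eps x := B r k / c * ev (dE T (dE A (u eps))) x
  + - a k 0 / c * ev (dE T (dE (Bd r) (u eps))) x - ev Z x * h2 eps x * B r k.
have sQ0 r : small_osc (Q0 r) by exact: small_oscZ.
have sQ1 r : small_osc (Q1 r).
  have := small_oscZ (p r 0) (small2 T A); congr small_osc.
  apply/funext => eps; apply/funext => x; rewrite /Q1 /h2 wT wA /u; field.
  by rewrite gt_eqF.
have sQ2 r k : small_osc (Q2 r k) by exact: small_oscZ.
have sQ3 r k : small_osc (Q3 r k).
  have := small_oscZ (p r 0) (small2 (X k) A); congr small_osc.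
  apply/funext => eps; apply/funext => x; rewrite /Q3 /h2 wX wA /u; field.
  by rewrite gt_eqF.
have sQ4 r k : small_osc (Q4 r k).
  have := small_oscD (small_oscZ (B r k / c) (small2 T A))
    (small_oscZ (- a k 0 / c) (small2 T (Bd r))); congr small_osc.
  apply/funext => eps; apply/funext => x; rewrite /Q4 /h2 wT wA wB /u; field.
  by rewrite !gt_eqF.
have e40 : 0 < e / 4 by rewrite divr_gt0.
have ww0 : 0 < dot w w.
  rewrite /dot (bigD1 (tcoord n))//= ltr_wpDr//.
    by apply: sumr_ge0 => j _; rewrite -expr2 sqr_ge0.
  by rewrite wc mulr_gt0.
(* Besides making the errors small, the wavelength is such that a shift by one full period,
   [(eps / dot w w) *: w], stays within the margin [rho]. *)
have [eps [eps0 epsrho [hQ0 hQ1 hQ2 hQ3 hQ4]]] : exists eps, [/\ 0 < eps,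
    eps / dot w w * `|w| <= rho &
    [/\ forall r x, `|Q0 r eps x| <= e / 4, forall r x, `|Q1 r eps x| <= e / 4,
        forall r k x, `|Q2 r k eps x| <= e / 4, forall r k x, `|Q3 r k eps x| <= e / 4 &
        forall r k x, `|Q4 r k eps x| <= e / 4]].
  have rw0 : 0 < rho * dot w w / (`|w| + 1) by rewrite divr_gt0 ?mulr_gt0// ltr_wpDl.
  apply: (@filter_ex _ (0 : R)^'+); near=> eps.
  have eps0 : 0 < eps by [].
  split=> //.
    have : eps <= rho * dot w w / (`|w| + 1) by near: eps; exact: nbhs_right_le.
    rewrite ler_pdivlMr ?ltr_wpDl// => h.
    rewrite mulrAC ler_pdivrMr// (le_trans _ h)//; apply: ler_wpM2l; first exact: ltW.
    by rewrite lerDl.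
  split.
  - by near: eps; apply: filter_forall => r; exact: small_osc_near.
  - by near: eps; apply: filter_forall => r; exact: small_osc_near.
  - by near: eps; apply: filter_forall => r; apply: filter_forall => k;
      exact: small_osc_near.
  - by near: eps; apply: filter_forall => r; apply: filter_forall => k;
      exact: small_osc_near.
  - by near: eps; apply: filter_forall => r; apply: filter_forall => k;
      exact: small_osc_near.
pose phi : coeff 1 := fun r _ => Mul (Cst _ (p r 0)) (dE A (u eps)).
pose g : coeff n := fun r k => Mul (Cst _ (p r 0 * a k 0)) (u eps).
pose psi : coeff n := fun r k => Add (Mul (Cst _ (B r k / c)) (dE A (u eps)))
  (Mul (Cst _ (- a k 0 / c)) (dE (Bd r) (u eps))).
have fieldE x : gradient_field phi psi x =
   (\matrix_(r, k) (p r 0 * ev (dE (X k) (dE A (u eps))) x),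
    \matrix_(r, k) (B r k / c * ev (dE T (dE A (u eps))) x
       + - a k 0 / c * ev (dE T (dE (Bd r) (u eps))) x)).
  rewrite gradient_fieldE; congr (_, _); apply/matrixP => r k; rewrite !mxE.
    by rewrite ev_dE_scale.
  by rewrite ev_dE_add !ev_dE_scale.
have h2b x : - l <= h2 eps x <= 1 - l by exact: Hl.
have Zh2 x : - l <= ev Z x * h2 eps x <= 1 - l.
  by have := Z01 x; have := h2b x; move: (ev Z x) (h2 eps x) => z h; nra.
have fieldU x : U x -> gradient_field phi psi x = h2 eps x *: (p *m a^T, B).
  move=> Ux; rewrite fieldE /h2; congr (_, _); apply/matrixP => r k.
    rewrite !mxE big_ord1 !mxE (ddosc_plateau H w alpha^-1 (X k) A eps0 oU ZU Ux).
    by rewrite wX wA; field; rewrite gt_eqF.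
  rewrite !mxE (ddosc_plateau H w alpha^-1 T A eps0 oU ZU Ux).
  rewrite (ddosc_plateau H w alpha^-1 T (Bd r) eps0 oU ZU Ux).
  by rewrite wT wA wB; field; rewrite !gt_eqF.
pose s b x := dot (eps^-1 *: w) x + - b.
have cs b : continuous (s b).
  by move=> x; exact: cvgD (@dot_continuous _ _ _ x) (@cst_continuous _ _ (- b) x).
have sE b x (z : int) : s b x - z%:~R = dot (eps^-1 *: w) x + 0 - b - z%:~R.
  by rewrite /s addr0.
have vs b L : 0 <= L <= 1 ->
    L * vol U' <= vol (U `&` [set x | exists z : int, 0 < s b x - z%:~R < L]).
  apply: (@vol_strips _ _ _ ((eps / dot w w) *: w)) => //.
  - move=> x t; rewrite /s dotD !dotZ !dotZl.
    by field; rewrite !gt_eqF.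
  - exact: sub_bounded_set (subset_trans UK KG) bG.
  - move=> x t Ux t1; apply: hU => //; rewrite normrZ normrZ.
    rewrite (ger0_norm (ltW (divr_gt0 eps0 ww0))).
    by apply: le_trans epsrho; rewrite ler_piMl// mulr_ge0// divr_ge0// ltW.
have vG0 := vol_ge0 G.
have volG1 (t L : R) : 0 <= t -> (1 - e / 2) * t <= L -> 0 <= L ->
    (1 - e) * t * vol G <= L * vol U'.
  move=> t0 tL L0; have e1' : 0 <= 1 - e / 2 by lra.
  apply: (@le_trans _ _ (((1 - e / 2) * t) * ((1 - e / 2) * vol G))).
    have -> : (1 - e / 2) * t * ((1 - e / 2) * vol G) =
      (1 - e) * t * vol G + (e / 2) ^+ 2 * (t * vol G) by field.
    by rewrite lerDl mulr_ge0 ?sqr_ge0// mulr_ge0.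
  by apply: ler_pM; rewrite ?mulr_ge0.
exists phi, psi, g, (U `&` [set x | exists z : int, 0 < s s1 x - z%:~R < L1]),
  (U `&` [set x | exists z : int, 0 < s s2 x - z%:~R < L2]).
split.
- split.
  + exists K; split=> // x Kx; split; apply/matrixP => i j; rewrite !mxE.
    * by rewrite ev_scale (dosc_off H w alpha^-1 cK ZK eps A Kx) mulr0.
    * rewrite ev_add !ev_scale (dosc_off H w alpha^-1 cK ZK eps A Kx).
      by rewrite (dosc_off H w alpha^-1 cK ZK eps (Bd i) Kx) !mulr0 addr0.
    * by rewrite ev_scale (osc_off H w alpha^-1 ZK eps Kx) mulr0.
  + move=> x; apply/matrixP => r j; rewrite !mxE.
    (* The divergence of row [r] is [1 / c] times the commutator of the derivatives along [Bd r] and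
       [A]. *)
    transitivity (c^-1 * (ev (dE (Bd r) (dE A (u eps))) x -
        ev (dE A (dE (Bd r) (u eps))) x)); last by rewrite ev_dEC subrr mulr0.
    rewrite [ev (dE (Bd r) (dE A _)) x]ev_dE_emb [ev (dE A (dE _ _)) x]ev_dE_emb.
    rewrite -sumrB mulr_sumr; apply: eq_bigr => k _.
    by rewrite partial_mev mxE ev_dE_add !ev_dE_scale; ring.
  + move=> x; apply/matrixP => r j; rewrite !mxE ev_scale.
    rewrite [ev (dE A _) x]ev_dE_emb mulr_sumr; apply: eq_bigr => k _.
    by rewrite partial_mev mxE ev_dE_scale mulrA.
  + move=> x; rewrite !dt_mev; split; apply: mx_norm_le => [|r j]; rewrite ?(ltW e0)// mxE.
    * by apply: le_trans (hQ0 r x) _; lra.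
    * rewrite ev_dE_scale -(subrK (p r 0 * (ev Z x * h2 eps x * c)) (_ * _)).
      apply: le_trans (ler_normD _ _) _.
      have -> : e = e / 2 + e / 4 + e / 4 by lra.
      apply: lerD; first by apply: le_trans (hQ1 r x) _; lra.
      have zh : `|ev Z x * h2 eps x| <= 1 by have := Zh2 x; rewrite ler_norml; lra.
      apply: le_trans (pc r); rewrite normrM [`|_ * c|]normrM (gtr0_norm c0) mulrCA.
      by apply: ler_piMl zh; rewrite mulr_ge0// ltW.
    * by rewrite ev_dE_scale; apply: le_trans (hQ2 r j x) _; lra.
- move=> x; exists (ev Z x * h2 eps x) => //.
  have e4e : e / 4 < e by lra.
  rewrite fieldE /dist2 gt_max; apply/andP; split;
    apply: le_lt_trans e4e; apply: mx_norm_le => [|r k]; rewrite ?(ltW e40)//.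
    by rewrite !mxE big_ord1 !mxE; exact: hQ3.
  by rewrite !mxE; exact: hQ4.
- split.
  + by apply: openI => //; exact: open_strips.
  + by apply: openI => //; exact: open_strips.
  + rewrite -subset0 => x [[_ [z1 h1]] [_ [z2 h3]]].
    move: h1 h3; rewrite !sE => /H1 + /H2 => ->; lra.
  + by exists K; split=> // x [/UK].
- split=> x [Ux [z]]; rewrite sE fieldU// /h2; first by move=> /H1 ->.
  by move=> /H2 ->.
- split.
    apply: le_trans (vs s1 L1 L1b); apply: volG1 => //; first exact: ltW.
    by case/andP: L1b.
  apply: le_trans (vs s2 L2 L2b); apply: volG1 => //; first lra.
  by case/andP: L2b.
Unshelve. all: by end_near.
Qed.

End Splitting.

(** * Cyclic averages *)

Section CyclicAverage.
Variables (R : realType) (N : nat).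
Implicit Types (i j : 'I_N) (t : 'I_N -> R).

Definition cyc_back i (l : nat) : 'I_N := insubd i ((i + N - l) %% N)%N.

Lemma val_cyc_back i l : (l <= N)%N ->
  val (cyc_back i l) = (if l <= i then i - l else i + N - l)%N.
Proof.
move=> lN; have iN := ltn_ord i; rewrite /cyc_back insubdK; last first.
  by rewrite -topredE /= ltn_pmod// (leq_ltn_trans _ iN).
case: leqP => li; last by rewrite modn_small//; lia.
by rewrite (_ : i + N - l = (i - l) + N)%N ?modnDr ?modn_small//; lia.
Qed.

Definition cyc_pred i := cyc_back i 1.

(** The number of backward steps from [cyc_pred i] to [j], hence the number of factors in the
    product of [cyc_nu]. *)
Definition cyc_dist i j : nat := (((i + N).-1 - j) %% N)%N.

Lemma cyc_distE i j : cyc_dist i j = (if j < i then (i - j).-1 else (i + N - j).-1)%N.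
Proof.
have iN := ltn_ord i; have jN := ltn_ord j; rewrite /cyc_dist.
case: ltnP => ji; last by rewrite modn_small; lia.
by rewrite (_ : (i + N).-1 - j = (i - j).-1 + N)%N ?modnDr ?modn_small//; lia.
Qed.

Lemma cyc_back_pred i l : (l < N)%N -> cyc_back (cyc_pred i) l = cyc_back i l.+1.
Proof.
move=> lN; have iN := ltn_ord i; apply: val_inj.
rewrite !val_cyc_back ?(ltnW lN)//; last by lia.
by do ! case: ifP; lia.
Qed.

Lemma prod_cyc_back i (F : 'I_N -> R) : \prod_(0 <= l < N) F (cyc_back i l) = \prod_j F j.
Proof.
rewrite big_mkord; have iN := ltn_ord i.
have inj : injective (fun l : 'I_N => cyc_back i l).
  move=> l l' /(congr1 val); rewrite !val_cyc_back ?(ltnW (ltn_ord _))// => h.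
  apply: val_inj; have := ltn_ord l; have := ltn_ord l'; move: h => /=.
  by do ! case: ifP; lia.
by rewrite [RHS](reindex_inj inj).
Qed.

Variable t : 'I_N -> R.
Hypothesis t01 : forall i, 0 < t i < 1.

Let q := \prod_(k < N) (1 - t k).

Let q1 (i : 'I_N) : 0 < 1 - q.
Proof.
rewrite subr_gt0 /q (bigD1 i)//=; have /andP[ti0 ti1] := t01 i.
apply: (@le_lt_trans _ _ (1 - t i)); last by lra.
have h : 0 <= \prod_(k < N | k != i) (1 - t k) <= 1.
  apply: (big_ind (fun x => 0 <= x <= 1)) => [|x y|k _]; first by rewrite ler01 lexx.
    by move=> /andP[x0 x1] /andP[y0 y1]; rewrite mulr_ge0 ?mulr_ile1.
  by have := t01 k; lra.
by apply: ler_piMr; [lra|case/andP: h].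
Qed.

Lemma cyc_nuE i j : cyc_nu t i j =
  \prod_(1 <= l < (cyc_dist i j).+1) (1 - t (cyc_back i l)) * t j / (1 - q).
Proof. by []. Qed.

Lemma cyc_nu_gt0 i j : 0 < cyc_nu t i j.
Proof.
rewrite cyc_nuE divr_gt0 ?q1// mulr_gt0//; last by case/andP: (t01 j).
by apply: prodr_gt0 => l _; rewrite subr_gt0; case/andP: (t01 (cyc_back i l)).
Qed.

(** For [j] other than [cyc_pred i] one factor splits off. For [j = cyc_pred i] the walk back from
    [cyc_pred i] makes a full turn and collects all of [q]; the claim becomes
    $t/(1-q)=t+qt/(1-q)$. *)
Lemma cyc_nu_rec i j : cyc_nu t i j = t (cyc_pred i) * (j == cyc_pred i)%:R +
  (1 - t (cyc_pred i)) * cyc_nu t (cyc_pred i) j.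
Proof.
have iN := ltn_ord i; have jN := ltn_ord j; have N0 : (0 < N)%N by lia.
have vp := val_cyc_back i N0; rewrite -/(cyc_pred i) in vp.
have q0 := q1 i; rewrite !cyc_nuE.
have [ji|ji] := eqVneq j (cyc_pred i).
  have -> : cyc_dist i j = 0.
    by rewrite cyc_distE ji vp; do ! case: ifP; lia.
  have -> : cyc_dist (cyc_pred i) j = N.-1.
    by rewrite cyc_distE ji ltnn; lia.
  rewrite big_geq// prednK// -ji mulr1 mul1r.
  set p := \prod_(1 <= l < N) _.
  have qE : q = (1 - t j) * p.
    rewrite /q -(prod_cyc_back j (fun k => 1 - t k)) big_ltn//; congr (_ * _).
    by congr (1 - t _); apply: val_inj; rewrite val_cyc_back//=; lia.
  have -> : (1 - t j) * (p * t j / (1 - q)) = q * t j / (1 - q).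
    by rewrite qE !mulrA.
  by field; rewrite gt_eqF.
have jv : (j : nat) != cyc_pred i by rewrite val_eqE.
have {}vp : (cyc_pred i : nat) = (if 1 <= i then i - 1 else i + N - 1)%N by exact: vp.
have -> : cyc_dist i j = (cyc_dist (cyc_pred i) j).+1.
  by rewrite !cyc_distE vp; move: jv; rewrite vp; do ! case: ifP; lia.
rewrite mulr0 add0r big_ltn// -/(cyc_pred i) !mulrA; congr (_ * _ * _ * _).
rewrite big_add1 /=; apply: eq_big_nat => l /andP[_ lN].
rewrite cyc_back_pred//; move: lN; rewrite cyc_distE; have := ltn_ord (cyc_pred i).
by case: ifP; lia.
Qed.

(** Uniqueness replaces unrolling: the difference [d] of two solutions satisfies the homogeneous
    recursion, and at an index where its modulus is largest the contraction factor [1 - t] forces it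
    to vanish. *)
Lemma cyc_average (P X : 'I_N -> R) :
  (forall i, P i = t (cyc_pred i) * X (cyc_pred i) +
    (1 - t (cyc_pred i)) * P (cyc_pred i)) ->
  forall i, P i = \sum_j cyc_nu t i j * X j.
Proof.
move=> hP; pose d i := P i - \sum_j cyc_nu t i j * X j.
have dE i : d i = (1 - t (cyc_pred i)) * d (cyc_pred i).
  rewrite /d hP; under eq_bigr do rewrite cyc_nu_rec mulrDl.
  rewrite big_split/= (bigD1 (cyc_pred i))//= eqxx mulr1 big1 => [|j /negbTE ->]; last first.
    by rewrite mulr0 mul0r.
  by under eq_bigr do rewrite -mulrA; rewrite -mulr_sumr; ring.
move=> i; have [k _ kmax] := @arg_maxP _ _ _ i xpredT (fun j => `|d j|) isT.
have dk : `|d k| = 0.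
  have h1 : `|d (cyc_pred k)| <= `|d k| by exact: kmax.
  have /andP[tk0 tk1] := t01 (cyc_pred k).
  have h2 : `|d k| = (1 - t (cyc_pred k)) * `|d (cyc_pred k)|.
    by rewrite dE normrM [`|1 - _|]ger0_norm//; lra.
  apply/eqP; rewrite eq_le normr_ge0 andbT.
  by have := normr_ge0 (d (cyc_pred k)); nra.
have : `|d i| <= `|d k| by exact: kmax.
by rewrite dk normr_le0 subr_eq0 => /eqP.
Qed.

Lemma cyc_nu_sum1 i : \sum_j cyc_nu t i j = 1.
Proof.
have h k : 1 = t (cyc_pred k) * 1 + (1 - t (cyc_pred k)) * 1 by ring.
rewrite [RHS](@cyc_average (fun=> 1) (fun=> 1) h i).
by apply: eq_bigr => j _; rewrite mulr1.
Qed.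

End CyclicAverage.

(** * Splitting along a wave-cone segment *)

Section Lamination.
Variables (R : realType) (m n : nat).
Local Notation V := 'rV[R]_n.+1.
Local Notation M := ('M[R]_(m, n) * 'M[R]_(m, n))%type.
Local Notation coeff k := ('I_m -> 'I_k -> expr R n.+1).
Implicit Types (x : V) (G U : set V) (phi : coeff 1) (psi g : coeff n) (z w eta : M).

Lemma nbhd_delta_mono (S S' : set M) (d d' : R) : S `<=` S' -> d <= d' ->
  nbhd_delta S d `<=` nbhd_delta S' d'.
Proof. by move=> SS dd z [s /SS Ss zs]; exists s => //; exact: lt_le_trans dd. Qed.

Lemma nbhd_delta_self (S : set M) (d : R) z : 0 < d -> S z -> nbhd_delta S d z.
Proof. by move=> d0 Sz; exists z => //; rewrite /dist2 !subrr !normr0 maxxx. Qed.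

Lemma dist2_addl z z' w : dist2 (w + z) (w + z') = dist2 z z'.
Proof.
have h (a b c : 'M[R]_(m, n)) : a + b - (a + c) = b - c.
  by rewrite opprD addrACA subrr add0r.
by rewrite /dist2 -[(w + z).1 - _]/(w.1 + z.1 - (w.1 + z'.1)) h
  -[(w + z).2 - _]/(w.2 + z.2 - (w.2 + z'.2)) h.
Qed.

Lemma segment_convex z1 z2 (l q : R) : - l <= q <= 1 - l ->
  segment z1 z2 (l *: z1 + (1 - l) *: z2 + q *: (z1 - z2)).
Proof.
move=> hq; exists (l + q); split; first lra.
rewrite scalerBr addrACA -scalerN -scalerDl; congr (_ + _).
by rewrite scalerN -scalerBl; congr (_ *: _); ring.
Qed.

Lemma split_exists z1 z2 (l e : R) G : wave_cone (z1 - z2) -> 0 <= l <= 1 ->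
  0 < e <= 1 -> open G -> bounded_set G ->
  exists phi psi g (G1 G2 : set V),
  [/\ perturbation G e phi psi g,
    forall x, nbhd_delta (segment z1 z2) e
      (l *: z1 + (1 - l) *: z2 + gradient_field phi psi x),
    [/\ open G1, open G2, G1 `&` G2 = set0 & exists K,
      [/\ compact K, K `<=` G, G1 `<=` K & G2 `<=` K]],
    (forall x, G1 x -> l *: z1 + (1 - l) *: z2 + gradient_field phi psi x = z1) /\
    (forall x, G2 x -> l *: z1 + (1 - l) *: z2 + gradient_field phi psi x = z2) &
    (1 - e) * l * vol G <= vol G1 /\ (1 - e) * (1 - l) * vol G <= vol G2].
Proof.
move=> [p [a [B [a0 [Ba zE]]]]] /andP[l0 l1] e01 oG bG; have /andP[e0 _] := e01.
have seg q : q = 1 - l \/ q = - l ->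
    l *: z1 + (1 - l) *: z2 + q *: (z1 - z2) = (if q == 1 - l then z1 else z2).
  have h r s : l + r = s -> l *: z1 + (1 - l) *: z2 + r *: (z1 - z2) =
      s *: z1 + (1 - s) *: z2.
    move=> <-; rewrite scalerBr addrACA -scalerN -scalerDl; congr (_ + _).
    by rewrite scalerN -scalerBl; congr (_ *: _); ring.
  case=> ->.
    by rewrite eqxx (h _ 1) ?subrr ?scale1r ?scale0r ?addr0//; ring.
  rewrite (h _ 0); last ring.
  case: eqP => [E|_]; last by rewrite subr0 scale1r scale0r add0r.
  by exfalso; move: E; lra.
(* At an endpoint no oscillation is added. The set is still [U] and not [G], because it must lie in
   a compact subset of [G]. *)
have [lE|l01] := pselect (l = 0 \/ l = 1).
  have [Z [K [U [U' [rho [cK KG Z01 ZK [oU UK ZU [rho0 oU' hU vU']]]]]]]] :=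
    cutoff_exists oG bG e0.
  have vUU : (1 - e) * vol G <= vol U.
    apply: (le_trans vU'); apply: le_vol.
      exact: sub_bounded_set (subset_trans UK KG) bG.
    by move=> x Ux; rewrite -(addr0 x); apply: hU; rewrite // normr0 ltW.
  exists (fun _ _ => Cst _ 0), (fun _ _ => Cst _ 0), (fun _ _ => Cst _ 0),
    (if l == 1 then U else set0), (if l == 1 then set0 else U).
  have l10 : (0 : R) == 1 = false by rewrite eq_sym oner_eq0.
  split.
  - by apply: perturbation0; exact: ltW.
  - move=> x; rewrite gradient_field0 addr0; apply: nbhd_delta_self => //.
    by exists l; rewrite l0 l1.
  - case: ifP => _; split; rewrite ?set0I ?setI0//; try exact: open0.
    + by exists K; split => //; exact: sub0set.
    + by exists K; split => //; exact: sub0set.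
  - by split=> x; rewrite gradient_field0 addr0; case: lE => ->;
      rewrite ?eqxx ?l10 ?subr0 ?subrr ?scale1r ?scale0r ?add0r ?addr0.
  - by split; case: lE => ->; rewrite ?eqxx ?l10 ?subr0 ?subrr ?mulr0 ?mulr1 ?mul0r
      ?vol0 ?lexx.
have l01' : 0 < l < 1.
  rewrite !lt_neqAle l0 l1 !andbT; apply/andP; split; apply/eqP => E; apply: l01.
    by left.
  by right.
have [phi [psi [g [G1 [G2 [pert near [oG1 oG2 G12 KG] [h1 h2] vols]]]]]] :=
  wave_exists p a0 Ba l01' e01 oG bG.
exists phi, psi, g, G1, G2; split=> //.
- move=> x; have [q ql hq] := near x.
  exists (l *: z1 + (1 - l) *: z2 + q *: (z1 - z2)); first exact: segment_convex.
  by rewrite dist2_addl zE.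
- split=> x Gx; rewrite ?(h1 _ Gx) ?(h2 _ Gx) -zE seg; [by rewrite eqxx|by left| |by right].
  by case: eqP => // E; exfalso; move: E; lra.
Qed.

Definition addE k (E1 E2 : coeff k) : coeff k := fun i j => Add (E1 i j) (E2 i j).

Lemma mev_add k (E1 E2 : coeff k) x : mev (addE E1 E2) x = mev E1 x + mev E2 x.
Proof. by apply/matrixP => i j; rewrite !mxE. Qed.

Lemma dt_mev_add k (E1 E2 : coeff k) x :
  dt (mev (addE E1 E2)) x = dt (mev E1) x + dt (mev E2) x.
Proof. by rewrite !dt_mev; apply/matrixP => i j; rewrite !mxE. Qed.

Lemma divx_mev_add (E1 E2 : coeff n) x :
  divx (mev (addE E1 E2)) x = divx (mev E1) x + divx (mev E2) x.
Proof.
apply/matrixP => i j; rewrite !mxE -big_split; apply: eq_bigr => k _ /=.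
by rewrite !partial_mev !mxE.
Qed.

Lemma gradient_field_add phi1 phi2 psi1 psi2 x :
  gradient_field (addE phi1 phi2) (addE psi1 psi2) x =
  gradient_field phi1 psi1 x + gradient_field phi2 psi2 x.
Proof.
rewrite !gradient_fieldE; congr (_, _); apply/matrixP => i j; rewrite !mxE//.
Qed.

Lemma gradient_field_off phi psi (K : set V) : compact K ->
  (forall x, ~ K x -> mev phi x = 0 /\ mev psi x = 0) ->
  forall x, ~ K x -> gradient_field phi psi x = 0.
Proof.
move=> cK h x Kx; rewrite gradient_fieldE; congr (_, _).
  apply/matrixP => i j; rewrite !mxE.
  have := @mev_dE_off R m n 1 phi (unitv R (xcoord j)) K cK (fun y Ky => (h y Ky).1) x Kx.
  by move/matrixP => /(_ i 0); rewrite !mxE.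
exact: mev_dE_off cK (fun y Ky => (h y Ky).2) x Kx.
Qed.

Lemma perturbation_add G G' (e e' : R) phi psi g phi' psi' g' : G' `<=` G ->
  perturbation G e phi psi g -> perturbation G' e' phi' psi' g' ->
  perturbation G (e + e') (addE phi phi') (addE psi psi') (addE g g').
Proof.
move=> GG [[K [cK KG K0]] d1 d2 sm] [[K' [cK' KG' K0']] d1' d2' sm'].
split=> [|x|x|x].
- exists (K `|` K'); split; first exact: compactU.
    by move=> x [/KG|/KG'/GG].
  by move=> x /not_orP[/K0[p1 p2 p3] /K0'[q1 q2 q3]]; rewrite !mev_add p1 p2 p3 q1 q2 q3 !addr0.
- by rewrite divx_mev_add d1 d1' addr0.
- by rewrite divx_mev_add mev_add d2 d2'.
- have [s1 s2 s3] := sm x; have [r1 r2 r3] := sm' x.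
  by rewrite mev_add !dt_mev_add; split; rewrite (le_trans (ler_normD _ _))// lerD.
Qed.

(** [wt j] is the share of [G] on which [xi j] is attained, up to the factor [1 - e]. A sum below 1
    means that some volume is not yet assigned to any [xi j]. *)
Definition solution N G (e : R) eta (T : set M) (xi : 'I_N -> M) (wt : 'I_N -> R) :=
  exists phi psi g (Gs : 'I_N -> set V),
  [/\ perturbation G e phi psi g,
    forall x, nbhd_delta T e (eta + gradient_field phi psi x),
    [/\ forall j, open (Gs j), forall j k x, Gs j x -> Gs k x -> j = k &
      exists K, [/\ compact K, K `<=` G & forall j, Gs j `<=` K]],
    forall j x, Gs j x -> eta + gradient_field phi psi x = xi j &
    forall j, (1 - e) * wt j * vol G <= vol (Gs j)].

(** The end of the recursion: nothing is added and no volume is claimed. *)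
Lemma solution0 N G (e : R) eta (T : set M) (xi : 'I_N -> M) : 0 < e -> T eta ->
  solution G e eta T xi (fun=> 0).
Proof.
move=> e0 Teta; exists (fun _ _ => Cst _ 0), (fun _ _ => Cst _ 0), (fun _ _ => Cst _ 0),
  (fun=> set0).
split=> //.
- by apply: perturbation0; exact: ltW.
- by move=> x; rewrite gradient_field0 addr0; exact: nbhd_delta_self.
- split; [by move=> _; exact: open0|by []|exists set0].
  by split=> [|x []|j x []]; exact: compact0.
- by move=> j; rewrite mulr0 mul0r vol0.
Qed.

(** The second perturbation has compact support in [G2], where the first field is exactly [z2]. So
    each point sees either the second field around [z2] or the first field unchanged, and distances
    to [T] do not accumulate. *)
Lemma solution_split N G (e l : R) z2 (T : set M) (xi : 'I_N -> M) (wt : 'I_N -> R) i :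
  wave_cone (xi i - z2) -> 0 <= l <= 1 -> 0 < e <= 1 -> open G -> bounded_set G ->
  segment (xi i) z2 `<=` T -> (forall j, 0 <= wt j) ->
  (forall G2, open G2 -> bounded_set G2 -> solution G2 (e / 2) z2 T xi wt) ->
  solution G e (l *: xi i + (1 - l) *: z2) T xi
    (fun j => l * (j == i)%:R + (1 - l) * wt j).
Proof.
move=> wc l01 /andP[e0 e1] oG bG sT wt0 sol2.
have e2 : 0 < e / 2 <= 1 by lra.
have [phi [psi [g [G1 [G2 [pert near [oG1 oG2 G12 [K [cK KG G1K G2K]]] [h1 h2] [v1 v2]]]]]]] :=
  split_exists wc l01 e2 oG bG.
set eta := l *: xi i + _ in near h1 h2 *.
have G2G : G2 `<=` G by exact: subset_trans KG.
have bG2 : bounded_set G2 by exact: sub_bounded_set bG.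
have [phi' [psi' [g' [Gs [pert' near' [oGs dGs [K' [cK' KG' GsK']]] hGs vGs]]]]] :=
  sol2 G2 oG2 bG2.
have [K2 [cK2 K2G K20]] : exists K, [/\ compact K, K `<=` G2 &
    forall x, ~ K x -> gradient_field phi' psi' x = 0].
  have [[K2 [cK2 K2G K20]] _ _ _] := pert'; exists K2; split=> //.
  by apply: gradient_field_off => // x /K20[].
have off x : ~ G2 x -> gradient_field phi' psi' x = 0.
  by move=> Gx; apply: K20 => /K2G.
have G1G2 x : G1 x -> ~ G2 x.
  by move=> G1x G2x; have : (G1 `&` G2) x by []; rewrite G12.
have fieldE x : eta + gradient_field (addE phi phi') (addE psi psi') x =
    if pselect (G2 x) then z2 + gradient_field phi' psi' x
    else eta + gradient_field phi psi x.
  rewrite gradient_field_add addrA; case: pselect => Gx; first by rewrite h2.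
  by rewrite off// addr0.
exists (addE phi phi'), (addE psi psi'), (addE g g'),
  (fun j => Gs j `|` (if j == i then G1 else set0)).
split.
- have -> : e = e / 2 + e / 2 by lra.
  exact: perturbation_add pert'.
- move=> x; rewrite fieldE; case: pselect => Gx.
    by apply: nbhd_delta_mono (near' x) => //; lra.
  by apply: nbhd_delta_mono (near x) => //; lra.
- split.
  + by move=> j; apply: openU => //; case: ifP => // _; exact: open0.
  + move=> j k x [Gj|]; last first.
      case: eqP => // -> G1x [/GsK'/KG'|]; first by move/(G1G2 _ G1x).
      by case: eqP => // ->.
    move=> [|]; first exact: dGs.
    by case: eqP => // _ /G1G2; case; exact: KG' (GsK' _ _ Gj).
  + exists K; split=> // j x [/GsK'/KG'/G2K//|].
    by case: eqP => // _ /G1K.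
- move=> j x [Gj|]; rewrite fieldE; case: pselect => Gx.
  + exact: hGs.
  + by exfalso; apply: Gx; exact: KG' (GsK' _ _ Gj).
  + by case: eqP => // _ /G1G2.
  + by case: eqP => // -> /h1.
- move=> j; rewrite vol_setU; last 4 first.
  + apply: sub_bounded_set bG => x [/GsK'/KG'/G2G//|].
    by case: eqP => // _ /G1K/KG.
  + exact: measurable_open.
  + by apply: measurable_open; case: ifP => // _; exact: open0.
  + rewrite -subset0 => x [/GsK'/KG' G2x].
    by case: eqP => // _ /G1G2.
  have vG := vol_ge0 G; have vG1 := vol_ge0 G1.
  have vj : (1 - e) * ((1 - l) * wt j) * vol G <= vol (Gs j).
    apply: le_trans (vGs j).
    apply: (@le_trans _ _ ((1 - e / 2) * wt j * ((1 - e / 2) * (1 - l) * vol G))).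
      have -> : (1 - e / 2) * wt j * ((1 - e / 2) * (1 - l) * vol G) =
        (1 - e) * ((1 - l) * wt j) * vol G +
        (e / 2) ^+ 2 * ((1 - l) * wt j * vol G) by field.
      by rewrite lerDl mulr_ge0 ?sqr_ge0// !mulr_ge0//; lra.
    by apply: ler_wpM2l => //; rewrite mulr_ge0//; lra.
  have vi : (1 - e) * (l * (j == i)%:R) * vol G <= vol (if j == i then G1 else set0).
    case: ifP => _; last by rewrite mulr0 mulr0 mul0r vol0.
    rewrite mulr1; apply: le_trans v1; apply: ler_wpM2r => //.
    by apply: ler_wpM2r; lra.
  by rewrite mulrDr mulrDl addrC lerD.
Qed.

End Lamination.

(** * T_N configurations *)

(** The reciprocal of the sum of the reciprocals; the added 1 covers an empty index type. *)
Lemma finite_lower_bound (R : realType) (I : finType) (F : I -> R) :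
  (forall k, 0 < F k) -> exists2 c, 0 < c & forall k, c <= F k.
Proof.
move=> F0; have S0 : 0 <= \sum_k (F k)^-1 by apply: sumr_ge0 => k _; rewrite invr_ge0 ltW.
exists (\sum_k (F k)^-1 + 1)^-1 => [|k]; first by rewrite invr_gt0 ltr_wpDl.
rewrite -[leRHS]invrK lef_pV2 ?posrE ?invr_gt0 ?ltr_wpDl//.
rewrite (bigD1 k)//= -addrA lerDl addr_ge0//.
by apply: sumr_ge0 => j _; rewrite invr_ge0 ltW.
Qed.

Lemma exists_expr_le (R : realType) (r e : R) : 0 <= r < 1 -> 0 < e ->
  exists k, r ^+ k <= e.
Proof.
move=> /andP[r0 r1] e0; have r1' : `|r| < 1 by rewrite ger0_norm.
have /cvgrPdist_lt/(_ _ e0) h := cvg_expr r1'.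
have [k] := filter_ex h; rewrite sub0r normrN => hk; exists k.
by apply/ltW; apply: le_lt_trans hk; rewrite ler_norm.
Qed.

Section TNConfiguration.
Variables (R : realType) (m n N : nat).
Local Notation M := ('M[R]_(m, n) * 'M[R]_(m, n))%type.
Variables (xi : 'I_N -> M) (rho : M) (gamma : 'I_N -> M) (kappa : 'I_N -> R).
Hypothesis TN : TN_config xi rho gamma kappa.

Local Notation tpi := (tpi rho gamma).
Local Notation chi := (chi kappa).

Let kappa1 i : 1 < kappa i. Proof. by have [] := TN. Qed.

Lemma chi01 i : 0 < chi i < 1.
Proof.
have k1 := kappa1 i; have k0 : 0 < kappa i by exact: lt_trans k1.
by rewrite /chi div1r invr_gt0 k0 invf_lt1.
Qed.

(** At index 0 this is the closing condition that the [gamma] sum to zero; it is what makes the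
    recursion cyclic. *)
Lemma tpi_pred i : tpi i = tpi (cyc_pred i) + gamma (cyc_pred i).
Proof.
have [_ _ sum0 _ _] := TN; have iN := ltn_ord i; have N0 : (0 < N)%N by lia.
have vp : (cyc_pred i : nat) = (if 1 <= i then i - 1 else i + N - 1)%N.
  by have := val_cyc_back i N0.
rewrite /tpi -addrA; congr (_ + _).
have sumD (P : pred 'I_N) : P (cyc_pred i) ->
    (forall j, P j && (j != cyc_pred i) = (j < cyc_pred i)%N) ->
    \sum_(j | P j) gamma j = \sum_(j < N | (j < cyc_pred i)%N) gamma j + gamma (cyc_pred i).
  by move=> Pp PE; rewrite (bigD1 _ Pp) addrC /=; congr (_ + _); exact: eq_bigl.
have [i0|i0] := posnP i.
  rewrite big_pred0 => [|j]; last by rewrite i0.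
  rewrite -(sumD xpredT)// => j; rewrite -val_eqE /= vp i0; have := ltn_ord j => jN.
  by rewrite ltnn add0n; apply/idP/idP; lia.
apply: sumD => [|j]; first by rewrite vp i0; lia.
by rewrite -val_eqE /= vp i0; apply/idP/idP; lia.
Qed.

Lemma tpi_split i : tpi i = chi (cyc_pred i) *: xi (cyc_pred i) +
  (1 - chi (cyc_pred i)) *: tpi (cyc_pred i).
Proof.
have [_ _ _ _ xiE] := TN; rewrite tpi_pred xiE; set j := cyc_pred i.
have kj : kappa j != 0 by rewrite gt_eqF// (lt_trans ltr01).
rewrite scalerDr scalerA /chi div1r mulVf// scale1r scalerBl scale1r.
by rewrite [RHS]addrAC subrKC.
Qed.

Lemma wave_cone_xi i : wave_cone (xi i - tpi i).
Proof.
have [_ cone _ _ xiE] := TN; rewrite xiE addrAC subrr add0r.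
have [p [a [B [a0 [Ba ->]]]]] := cone i.
exists (kappa i *: p), a, (kappa i *: B); split=> //; split.
  by rewrite -scalemxAl Ba scaler0.
by rewrite -scalemxAl.
Qed.

(** The recursion for [nu_eta], cut off after [k.+1] splittings; what is left at that depth counts
    as 0. *)
Fixpoint lam_weight (k : nat) (i : 'I_N) (l : R) (j : 'I_N) : R :=
  l * (j == i)%:R + (1 - l) *
    (if k is k'.+1 then lam_weight k' (cyc_pred i) (chi (cyc_pred i)) j else 0).

Lemma lam_weight_ge0 k i l j : 0 <= l <= 1 -> 0 <= lam_weight k i l j.
Proof.
elim: k i l => [|k IH] i l /andP[l0 l1] /=.
  by rewrite mulr0 addr0 mulr_ge0.
rewrite addr_ge0 ?mulr_ge0 ?subr_ge0//; apply: IH.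
by have := chi01 (cyc_pred i); lra.
Qed.

Lemma lamination k i l e G : 0 <= l <= 1 -> 0 < e <= 1 -> open G -> bounded_set G ->
  solution G e (l *: xi i + (1 - l) *: tpi i) (Tset xi rho gamma) xi
    (lam_weight k i l).
Proof.
elim: k i l e G => [|k IH] i l e G l01 e01 oG bG.
  apply: solution_split => //; first exact: wave_cone_xi.
    by move=> z sz; exists i.
  move=> G2 _ _; apply: solution0; first by case/andP: e01 => e0 _; rewrite divr_gt0.
  by exists i => //; exists 0; rewrite lexx ler01 scale0r subr0 scale1r add0r.
apply: (@solution_split _ _ _ _ _ _ _ (tpi i) _ _
   (lam_weight k (cyc_pred i) (chi (cyc_pred i)))) => //.
- exact: wave_cone_xi.
- by move=> z sz; exists i.
- by move=> j; apply: lam_weight_ge0; have := chi01 (cyc_pred i); lra.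
- move=> G2 oG2 bG2; rewrite [in X in solution _ _ X]tpi_split; apply: IH => //.
    by have := chi01 (cyc_pred i); lra.
  by have := e01; lra.
Qed.

Lemma nu_etaE i l j : nu_eta kappa i l j = l * (j == i)%:R + (1 - l) * cyc_nu chi i j.
Proof.
rewrite /nu_eta; case: eqP => [->|_]; first by rewrite mulr1.
by rewrite mulr0 add0r.
Qed.

Lemma cyc_nu_nu_eta i j :
  cyc_nu chi i j = nu_eta kappa (cyc_pred i) (chi (cyc_pred i)) j.
Proof. by rewrite nu_etaE -(cyc_nu_rec chi01). Qed.

Lemma nu_eta_sum1 i l : \sum_j nu_eta kappa i l j = 1.
Proof.
under eq_bigr do rewrite nu_etaE.
rewrite big_split/= -!mulr_sumr (cyc_nu_sum1 chi01) (bigD1 i)//= eqxx.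
by rewrite big1 => [|j /negbTE -> //]; rewrite addr0 /= mulr1 mulr1 addrC subrK.
Qed.

Lemma cyc_nu_le1 i j : cyc_nu chi i j <= 1.
Proof.
rewrite -(cyc_nu_sum1 chi01 i) (bigD1 j)//= lerDl.
by apply: sumr_ge0 => k _; rewrite ltW// (cyc_nu_gt0 chi01).
Qed.

(** Both weights obey the same recursion, so their gap is the tail that was cut off: a coefficient
    at most 1, multiplied by some [1 - chi] at each of the [k] further rounds. *)
Lemma lam_weight_gap r k i l j : (forall j, 1 - chi j <= r) -> 0 <= l <= 1 ->
  nu_eta kappa i l j - lam_weight k i l j <= (1 - l) * r ^+ k.
Proof.
move=> hr; elim: k i l => [|k IH] i l /andP[l0 l1].
  rewrite nu_etaE /= mulr0 addr0 addrAC subrr add0r expr0.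
  by rewrite ler_wpM2l ?subr_ge0 ?cyc_nu_le1.
rewrite nu_etaE /= opprD addrACA subrr add0r -mulrBr ler_wpM2l ?subr_ge0//.
rewrite cyc_nu_nu_eta; have /andP[c0 c1] := chi01 (cyc_pred i).
apply: (le_trans (IH _ _ _)); first by rewrite (ltW c0) (ltW c1).
rewrite exprS ler_wpM2r// exprn_ge0// (le_trans _ (hr (cyc_pred i)))//.
by rewrite subr_ge0 ltW.
Qed.

(** The additive gap becomes a relative one because [nu_eta] is at least [(1 - l) * b], with [b] a
    positive lower bound for all [cyc_nu]. The factor [1 - l] in the gap matters: for [l = 1] all
    weights but one are 0. *)
Lemma lam_weight_limit l (d : R) : 0 <= l <= 1 -> 0 < d ->
  exists k, forall i j, (1 - d) * nu_eta kappa i l j <= lam_weight k i l j.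
Proof.
move=> /andP[l0 l1] d0; have [c c0 hc] := @finite_lower_bound R _ chi (fun k => (andP (chi01 k)).1).
have [b b0 hb] := @finite_lower_bound R _ (fun ij : 'I_N * 'I_N => cyc_nu chi ij.1 ij.2)
  (fun ij => cyc_nu_gt0 chi01 ij.1 ij.2).
pose r := Num.max 0 (1 - c).
have r01 : 0 <= r < 1 by rewrite le_max lexx gt_max ltr01 ltrBlDr ltrDl.
have hr j : 1 - chi j <= r by rewrite le_max lerD2l lerN2 hc orbT.
have [k hk] := exists_expr_le r01 (mulr_gt0 d0 b0).
exists k => i j; have l01 : 0 <= l <= 1 by rewrite l0.
have := lam_weight_gap k i j hr l01 => /le_trans gap.
have : (1 - l) * r ^+ k <= d * nu_eta kappa i l j; last by move=> /gap; lra.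
apply: (@le_trans _ _ ((1 - l) * (d * b))); first by rewrite ler_wpM2l// subr_ge0.
rewrite mulrCA ler_wpM2l ?(ltW d0)// nu_etaE.
apply: (@le_trans _ _ ((1 - l) * cyc_nu chi i j)).
  by rewrite ler_wpM2l ?subr_ge0//; exact: (hb (i, j)).
by rewrite lerDr mulr_ge0.
Qed.

(** [cyc_average] is scalar; it is applied to every matrix entry through the linear functional
    [c]. *)
Lemma eta_average i l : l *: xi i + (1 - l) *: tpi i = \sum_j nu_eta kappa i l j *: xi j.
Proof.
have coord (c : M -> R) : (forall (a b : R) y z, c (a *: y + b *: z) = a * c y + b * c z) ->
    c (l *: xi i + (1 - l) *: tpi i) = c (\sum_j nu_eta kappa i l j *: xi j).
  move=> lin; have c0 : c 0 = 0.
    by have := lin 0 0 0 0; rewrite !scale0r addr0 !mul0r addr0.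
  have cD y z : c (y + z) = c y + c z by rewrite -[y in LHS]scale1r -[z in LHS]scale1r lin !mul1r.
  have cZ a y : c (a *: y) = a * c y.
    by rewrite -[in LHS](addr0 (a *: y)) -(scale0r 0) lin mul0r addr0.
  rewrite lin (@cyc_average _ _ _ chi01 (fun k => c (tpi k)) (fun k => c (xi k))) => [|k]; last first.
    by rewrite tpi_split lin.
  rewrite (big_morph c cD c0); under [RHS]eq_bigr do rewrite cZ nu_etaE mulrDl.
  rewrite big_split/= [X in _ = X + _](bigD1 i)//= eqxx mulr1.
  rewrite [X in _ = _ + X + _]big1 => [|j /negbTE ->]; last first.
    by rewrite mulr0 mul0r.
  by rewrite addr0 mulr_sumr; congr (_ + _); apply: eq_bigr => j _; rewrite mulrA.
rewrite [LHS]surjective_pairing [RHS]surjective_pairing; congr (_, _).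
  apply/matrixP => r k; apply: (coord (fun z => z.1 r k)) => a b y z.
  by rewrite /= !mxE.
apply/matrixP => r k; apply: (coord (fun z => z.2 r k)) => a b y z.
by rewrite /= !mxE.
Qed.

End TNConfiguration.

Lemma compactly_containedW (R : realType) d (A K G : set 'rV[R]_d) :
  compact K -> A `<=` K -> K `<=` G -> compactly_contained A G.
Proof.
move=> cK AK KG.
have clK : closure A `<=` K.
  have /closure_id -> : closed K by exact: compact_closed.
  exact: closureS.
by split; [apply: subclosed_compact cK clK; exact: closed_closure|exact: subset_trans KG].
Qed.

Lemma supnorm_le (R : realType) d (W : normedModType R) (G : set 'rV[R]_d)
  (f : 'rV[R]_d -> W) (e : R) : (forall x, `|f x| <= e) -> (supnorm G f <= e%:E)%E.
Proof. by move=> h; apply: ge_ereal_sup => _ [x _ <-]; rewrite lee_fin. Qed.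

Theorem theorem3p5 (R : realType) (m n N : nat)
    (xi : 'I_N -> ('M[R]_(m, n) * 'M[R]_(m, n))%type)
    (rho : ('M[R]_(m, n) * 'M[R]_(m, n))%type)
    (gamma : 'I_N -> ('M[R]_(m, n) * 'M[R]_(m, n))%type)
    (kappa : 'I_N -> R)
    (i : 'I_N) (lambda : R) (eta : ('M[R]_(m, n) * 'M[R]_(m, n))%type) :
  TN_config xi rho gamma kappa ->
  0 <= lambda <= 1 ->
  eta = lambda *: xi i + (1 - lambda) *: tpi rho gamma i ->
  eta = \sum_(j < N) nu_eta kappa i lambda j *: xi j /\
  (forall (G : set 'rV[R]_(n.+1)) (delta : R),
     open G -> bounded_set G -> 0 < delta < 1 ->
     exists (phi : 'rV[R]_(n.+1) -> 'cV[R]_m)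
            (psi g : 'rV[R]_(n.+1) -> 'M[R]_(m, n)),
       [/\ [/\ Cc_infty G phi, Cc_infty G psi & Cc_infty G g],
           (* (a) *)
           (forall p, G p ->
              [/\ divx psi p = 0, divx g p = phi p &
                  nbhd_delta (Tset xi rho gamma) delta
                    (eta + (Dx phi p, dt psi p))]),
           (* (b) *)
           (supnorm G phi + supnorm G (dt phi) + supnorm G (dt g)
              < delta%:E)%E &
           (* (c) *)
           exists Gs : 'I_N -> set 'rV[R]_(n.+1),
             [/\ (forall j, open (Gs j)) /\
                   (forall j k, j != k -> Gs j `&` Gs k = set0),
                 (forall j, compactly_contained (Gs j) G),
                 (forall j p, Gs j p -> eta + (Dx phi p, dt psi p) = xi j),
                 (forall j, (((1 - delta) * nu_eta kappa i lambda j)%:E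
                               * leb_measure G <= leb_measure (Gs j))%E) &
                 ((1 - delta)%:E * leb_measure G
                    <= \sum_(j < N) leb_measure (Gs j))%E]]).
Proof.
move=> TN l01 ->; split; first exact: eta_average.
move=> G delta oG bG /andP[d0 d1].
have d20 : 0 < delta / 2 by rewrite divr_gt0.
have [k hk] := lam_weight_limit TN l01 d20.
(* Three norms of at most [delta / 4] stay below [delta], and together with the loss [delta / 2] in
   the weights the volume factor is $(1-\delta/4)(1-\delta/2)\ge1-\delta$. *)
have d4 : 0 < delta / 4 <= 1 by lra.
have [phi [psi [g [Gs [pert near [oGs dGs [K [cK KG GsK]]] hGs vGs]]]]] :=
  lamination TN k i l01 d4 oG bG.
have [[K' [cK' KG' off]] div1 div2 sm] := pert.
have Cc k' (E : 'I_m -> 'I_k' -> expr R n.+1) :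
    (forall x, ~ K' x -> mev E x = 0) -> Cc_infty G (mev E).
  move=> E0; split; first exact: smooth_mev.
  apply: compactly_containedW cK' _ KG' => x /eqP Ex; apply: contrapT => /E0.
  exact: Ex.
have bGs j : bounded_set (Gs j) by apply: sub_bounded_set bG => x /GsK/KG.
have nu0 j : 0 <= nu_eta kappa i lambda j.
  have /andP[l0 l1] := l01; rewrite nu_etaE.
  apply: addr_ge0; first by rewrite mulr_ge0.
  by apply: mulr_ge0; [rewrite subr_ge0|exact: ltW (cyc_nu_gt0 (chi01 TN) i j)].
have volj j : (1 - delta) * nu_eta kappa i lambda j * vol G <= vol (Gs j).
  apply: le_trans (vGs j); apply: ler_wpM2r; first exact: vol_ge0.
  apply: (@le_trans _ _ ((1 - delta / 4) * ((1 - delta / 2) * nu_eta kappa i lambda j))).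
    by rewrite mulrA; apply: ler_wpM2r => //; nra.
  by apply: ler_wpM2l (hk i j); lra.
exists (mev phi), (mev psi), (mev g); split.
- by split; apply: Cc => x /off[].
- move=> x _; split=> //.
  by apply: nbhd_delta_mono (near x) => //; lra.
- apply: (@le_lt_trans _ _ ((delta / 4)%:E + (delta / 4)%:E + (delta / 4)%:E)%E).
    by rewrite !leeD// supnorm_le// => x; have [] := sm x.
  by rewrite -!EFinD lte_fin; lra.
- exists Gs; split=> //.
  + split=> // j k' jk; rewrite -subset0 => x [h1 h2].
    by move/eqP: jk; apply; exact: dGs h1 h2.
  + by move=> j; exact: compactly_containedW cK (GsK j) KG.
  + by move=> j; rewrite !volE// -EFinM lee_fin volj.
  + rewrite volE// (eq_bigr (fun j => (vol (Gs j))%:E)) => [|j _]; last by rewrite volE.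
    rewrite -EFinM sumEFin lee_fin.
    rewrite -[1 - delta in leLHS]mulr1 -[X in _ * X * _](nu_eta_sum1 TN i lambda).
    rewrite mulr_sumr mulr_suml.
    by apply: ler_sum => j _; exact: volj.
Qed.
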